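(* If $k$ is an imperfect field, then there exists a regular irreducible $k$-variety $X$ such that $\mathcal{L}(X)$ is not irreducible.
   Context: A $k$-variety is a reduced separated $k$-scheme of finite type. For a $k$-scheme $X$ and $n\in\mathbb{N}$, the $n$-jet scheme $\mathcal{L}_n(X)=\mathcal{L}_n(X/k)$ is the $k$-scheme representing the functor $Z\mapsto \mathrm{Hom}_k(Z\times_{\mathbb{Z}}\mathrm{Spec}\,\mathbb{Z}[t]/(t^{n+1}),X)$ on $k$-schemes. The arc scheme is $\mathcal{L}(X)=\mathcal{L}(X/k)=\varprojlim_n\mathcal{L}_n(X)$ along the (affine) truncation morphisms given by reduction modulo $t^{n+1}$. For affine $X$, $\mathcal{L}(X)$ represents the functor $A\mapsto X(A[[t]])$ on $k$-algebras. *)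

(* Defs.v *)
From HB Require Import structures.
From mathcomp Require Import all_boot all_order all_algebra all_field.
From mathcomp Require Import boolp classical_sets.

Set Implicit Arguments.
Unset Strict Implicit.
Unset Printing Implicit Defensive.

Import GRing.Theory.
Local Open Scope classical_set_scope.
Local Open Scope ring_scope.

(* Schemes over a field k are handled through their functors of points: a
   k-scheme is a functor from commutative k-algebras to sets which is a sheaf
   for the Zariski topology and is covered by open affine subfunctors
   (Demazure-Gabriel, I.1; Eisenbud-Harris, VI).  Rings are [comPzRingType]s,
   since the zero ring (the empty affine scheme) must be allowed. *)

(* a field k is imperfect when [~ perfect_field k] *)
Definition perfect_field (k : fieldType) :=
  forall f : {poly k}, irreducible_poly f -> separable_poly f.

Section CommutativeAlgebra.
Variable R : comPzRingType.

Definition is_unit (x : R) := exists y, x * y = 1.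

Definition ideal (I : set R) :=
  [/\ I 0, forall x y, I x -> I y -> I (x + y) & forall a x, I x -> I (a * x)].

Definition ideal_gen (S : set R) : set R := [set x |
  exists (n : nat) (a s : 'I_n -> R),
    (forall i, S (s i)) /\ x = \sum_i a i * s i].

Definition prime_ideal (P : set R) :=
  [/\ ideal P, ~ P 1 & forall x y, P (x * y) -> P x \/ P y].

Definition maximal_ideal (M : set R) :=
  [/\ ideal M, ~ M 1 & forall I, ideal I -> ~ I 1 -> M `<=` I -> I = M].

Definition is_local_ring (M : set R) :=
  maximal_ideal M /\ forall M', maximal_ideal M' -> M' = M.

Definition noetherian := forall I, ideal I ->
  exists (n : nat) (s : 'I_n -> R), I = ideal_gen (range s).

Definition prime_chain (d : nat) (P : nat -> set R) :=
  (forall i, (i <= d)%N -> prime_ideal (P i)) /\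
  (forall i, (i < d)%N -> P i `<` P i.+1).

Definition krull_dim (d : nat) :=
  (exists P, prime_chain d P) /\ ~ (exists P, prime_chain d.+1 P).

Definition regular_local_ring :=
  noetherian /\ exists (M : set R) (d : nat),
    [/\ is_local_ring M, krull_dim d &
        exists s : 'I_d -> R, M = ideal_gen (range s)].

Definition reduced_ring := forall (x : R) (n : nat), x ^+ n = 0 -> x = 0.

Definition powers (f : R) : set R := range (fun n : nat => f ^+ n).

End CommutativeAlgebra.

(* h exhibits B as the ring of fractions S^-1 A *)
Definition is_localization (A B : comPzRingType) (S : set A)
    (h : {rmorphism A -> B}) :=
  [/\ forall s, S s -> is_unit (h s),
      forall b, exists a s, S s /\ b * h s = h a
    & forall a, h a = 0 -> exists2 s, S s & s * a = 0].

Section TruncatedPolynomials.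
Variables (n : nat) (A : comPzRingType).

(* A[t]/(t^(n+1)), as coefficient families; {poly A} is not available for the
   zero ring *)
Definition tpoly := {ffun 'I_n.+1 -> A}.

HB.instance Definition _ := GRing.Zmodule.on tpoly.

Definition tpoly_const (a : A) : tpoly :=
  [ffun i => if i == ord0 then a else 0].

Definition tpoly_mul (f g : tpoly) : tpoly :=
  [ffun i : 'I_n.+1 => \sum_(j < n.+1) \sum_(l < n.+1 | (j + l)%N == i)
     f j * g l].

Fact tpoly_mulC : commutative tpoly_mul.
Proof.
move=> f g; apply/ffunP => i; rewrite !ffunE (exchange_big_dep predT) //=.
by apply: eq_bigr => l _; apply: eq_big => j; [rewrite addnC | rewrite mulrC].
Qed.

Fact tpoly_sum (m : nat) (i : 'I_n.+1) (X : 'I_n.+1 -> 'I_n.+1 -> A) :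
  \sum_(p < n.+1 | (p + m)%N == i) \sum_(j < n.+1)
     \sum_(l < n.+1 | (j + l)%N == p) X j l =
  \sum_(j < n.+1) \sum_(l < n.+1 | (j + l + m)%N == i) X j l.
Proof.
rewrite exchange_big /=; apply: eq_bigr => j _.
rewrite (exchange_big_dep predT) //= [RHS]big_mkcond /=.
apply: eq_bigr => l _; case: eqP => [e | ne]; last first.
  by rewrite big_pred0 // => p; apply/andP => -[/eqP e /eqP e']; rewrite e' in ne.
have lt : (j + l < n.+1)%N.
  by apply: leq_ltn_trans (ltn_ord i); rewrite -e leq_addr.
rewrite (big_pred1 (Ordinal lt)) // => p; rewrite -[RHS]val_eqE /=.
by rewrite [RHS]eq_sym andbC; case: eqP => //= <-; rewrite e eqxx.
Qed.

Fact tpoly_mulA : associative tpoly_mul.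
Proof.
have mulE f g h (i : 'I_n.+1) : tpoly_mul (tpoly_mul f g) h i =
    \sum_(m < n.+1) \sum_(j < n.+1) \sum_(l < n.+1 | (j + l + m)%N == i)
      f j * g l * h m.
  rewrite ffunE (exchange_big_dep predT) //=; apply: eq_bigr => m _.
  rewrite -tpoly_sum; apply: eq_bigr => p _; rewrite ffunE mulr_suml.
  by apply: eq_bigr => j _; rewrite mulr_suml.
move=> f g h; apply/ffunP => i; rewrite (tpoly_mulC f) !mulE.
rewrite [RHS]exchange_big /=; apply: eq_bigr => j _.
rewrite (exchange_big_dep predT) //=; apply: eq_bigr => m _.
apply: eq_big => l; first by rewrite addnC addnA.
by rewrite mulrC mulrA.
Qed.

Fact tpoly_mul1r : left_id (tpoly_const 1) tpoly_mul.
Proof.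
move=> f; apply/ffunP => i; rewrite ffunE (bigD1 ord0) //=.
rewrite [X in _ + X]big1 ?addr0 => [|j /negPf j0].
  by rewrite (big_pred1 i) => [|l]; rewrite ?ffunE ?mul1r // add0n.
by rewrite big1 // => l _; rewrite ffunE j0 mul0r.
Qed.

Fact tpoly_mulDl : left_distributive tpoly_mul +%R.
Proof.
move=> f g h; apply/ffunP => i; rewrite !ffunE -big_split.
apply: eq_bigr => j _; rewrite -big_split.
by apply: eq_bigr => l _; rewrite ffunE mulrDl.
Qed.

HB.instance Definition _ := GRing.Zmodule_isComPzRing.Build tpoly
  tpoly_mulA tpoly_mulC tpoly_mul1r tpoly_mulDl.

Fact tpoly_const_zmod : zmod_morphism tpoly_const.
Proof.
by move=> a b; apply/ffunP => i; rewrite !ffunE; case: ifP; rewrite ?subr0.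
Qed.

Fact tpoly_const_monoid : monoid_morphism tpoly_const.
Proof.
split=> // a b; apply/ffunP => i; rewrite !ffunE (bigD1 ord0) //=.
rewrite [X in _ + X]big1 ?addr0 => [|j /negPf j0]; last first.
  by rewrite big1 // => l _; rewrite ffunE j0 mul0r.
rewrite (big_pred1 i) => [|l]; last by rewrite add0n.
by rewrite !ffunE /=; case: ifP; rewrite ?mulr0.
Qed.

HB.instance Definition _ := GRing.isZmodMorphism.Build A tpoly tpoly_const
  tpoly_const_zmod.
HB.instance Definition _ := GRing.isMonoidMorphism.Build A tpoly tpoly_const
  tpoly_const_monoid.

End TruncatedPolynomials.

Definition tpoly_map (n : nat) (A B : comPzRingType) (h : {rmorphism A -> B})
    (f : tpoly n A) : tpoly n B := [ffun i => h (f i)].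

Fact tpoly_map_zmod n A B h : zmod_morphism (@tpoly_map n A B h).
Proof. by move=> f g; apply/ffunP => i; rewrite !ffunE rmorphB. Qed.

Fact tpoly_map_monoid n A B h : monoid_morphism (@tpoly_map n A B h).
Proof.
split=> [|f g]; apply/ffunP => i; rewrite !ffunE.
  by case: ifP; rewrite ?rmorph1 ?rmorph0.
rewrite rmorph_sum; apply: eq_bigr => j _; rewrite rmorph_sum.
by apply: eq_bigr => l _; rewrite rmorphM !ffunE.
Qed.

HB.instance Definition _ n A B h := GRing.isZmodMorphism.Build
  (tpoly n A) (tpoly n B) (@tpoly_map n A B h) (@tpoly_map_zmod n A B h).
HB.instance Definition _ n A B h := GRing.isMonoidMorphism.Build
  (tpoly n A) (tpoly n B) (@tpoly_map n A B h) (@tpoly_map_monoid n A B h).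

(* reduction modulo t^(n+1) *)
Definition tpoly_trunc (n : nat) (A : comPzRingType) (f : tpoly n.+1 A) :
  tpoly n A := [ffun i => f (widen_ord (leqnSn n.+1) i)].

Fact tpoly_trunc_zmod n A : zmod_morphism (@tpoly_trunc n A).
Proof. by move=> f g; apply/ffunP => i; rewrite !ffunE. Qed.

Fact tpoly_trunc_monoid n A : monoid_morphism (@tpoly_trunc n A).
Proof.
split=> [|f g]; apply/ffunP => i; rewrite !ffunE; first by rewrite -val_eqE.
rewrite big_ord_recr /= [X in _ + X]big_pred0 ?addr0 => [|l]; last first.
  by apply: gtn_eqF; rewrite ltn_addr.
apply: eq_bigr => j _; rewrite big_mkcond big_ord_recr /= ifF ?addr0.
  by rewrite -big_mkcond; apply: eq_bigr => l _; rewrite !ffunE.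
by apply: gtn_eqF; rewrite ltn_addl.
Qed.

HB.instance Definition _ n A := GRing.isZmodMorphism.Build
  (tpoly n.+1 A) (tpoly n A) (@tpoly_trunc n A) (@tpoly_trunc_zmod n A).
HB.instance Definition _ n A := GRing.isMonoidMorphism.Build
  (tpoly n.+1 A) (tpoly n A) (@tpoly_trunc n A) (@tpoly_trunc_monoid n A).

Section KAlgebras.
Variable k : fieldType.

Record kalg := KAlg {
  kalg_ring :> comPzRingType;
  kalg_str : {rmorphism k -> kalg_ring} }.

Record khom (A B : kalg) := KHom {
  khom_fun :> {rmorphism A -> B};
  khom_str : forall c, khom_fun (kalg_str A c) = kalg_str B c }.

Fact khom_ext (A B : kalg) (f g : khom A B) : f =1 g -> f = g.
Proof.
case: f g => [[f [[fa] [fm]]] fs] [[g [[ga] [gm]]] gs] /= /funext fg.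
move: fa fm fs; rewrite {}fg => fa fm fs.
by rewrite (Prop_irrelevance fa ga) (Prop_irrelevance fm gm) in fs *;
  rewrite (Prop_irrelevance fs gs).
Qed.

Fact khom_comp_str (A B C : kalg) (g : khom B C) (f : khom A B) c :
  (g \o f) (kalg_str A c) = kalg_str C c.
Proof. by rewrite /= !khom_str. Qed.

Definition khom_comp (A B C : kalg) (g : khom B C) (f : khom A B) : khom A C :=
  @KHom A C (g \o f : {rmorphism A -> C}) (khom_comp_str g f).

Definition finitely_generated (A : kalg) := exists (n : nat) (s : 'I_n -> A),
  forall P : set A,
    (forall c, P (kalg_str A c)) ->
    (forall x y, P x -> P y -> P (x + y)) ->
    (forall x y, P x -> P y -> P (x * y)) ->
    (forall i, P (s i)) -> forall x, P x.

Definition tpoly_alg (n : nat) (A : kalg) : kalg :=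
  KAlg (@tpoly_const n A \o kalg_str A : {rmorphism k -> tpoly n A}).

Fact tpoly_hom_str n (A B : kalg) (h : khom A B) c :
  tpoly_map h (kalg_str (tpoly_alg n A) c) = kalg_str (tpoly_alg n B) c.
Proof.
apply/ffunP => i; rewrite !ffunE /=.
by case: ifP => _; rewrite ?rmorph0 ?khom_str.
Qed.

Definition tpoly_hom n (A B : kalg) (h : khom A B) :
    khom (tpoly_alg n A) (tpoly_alg n B) :=
  @KHom (tpoly_alg n A) (tpoly_alg n B)
    (@tpoly_map n A B h : {rmorphism tpoly n A -> tpoly n B})
    (@tpoly_hom_str n A B h).

Fact trunc_hom_str n (A : kalg) c :
  tpoly_trunc (kalg_str (tpoly_alg n.+1 A) c) = kalg_str (tpoly_alg n A) c.
Proof. by apply/ffunP => i; rewrite !ffunE -val_eqE. Qed.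

Definition trunc_hom n (A : kalg) : khom (tpoly_alg n.+1 A) (tpoly_alg n A) :=
  @KHom (tpoly_alg n.+1 A) (tpoly_alg n A)
    (@tpoly_trunc n A : {rmorphism tpoly n.+1 A -> tpoly n A})
    (@trunc_hom_str n A).

Record kfunctor := KFunctor {
  fobj :> kalg -> Type;
  fmap : forall A B : kalg, khom A B -> fobj A -> fobj B;
  fmap_id : forall (A : kalg) (h : khom A A) (x : fobj A),
    h =1 id -> fmap h x = x;
  fmap_comp : forall (A B C : kalg) (h : khom A B) (g : khom B C) (x : fobj A),
    fmap (khom_comp g h) x = fmap g (fmap h x) }.

Implicit Type F : kfunctor.

Definition subfunctor F (U : forall A, F A -> Prop) : Prop :=
  forall (A B : kalg) (h : khom A B) (x : F A), U A x -> U B (fmap h x).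

(* the preimage of U under any x : Sp A -> F is the complement of V(I) *)
Definition open_subfunctor F (U : forall A, F A -> Prop) : Prop :=
  subfunctor U /\
  forall (A : kalg) (x : F A), exists2 I : set A, ideal I &
    forall (B : kalg) (h : khom A B),
      U B (fmap h x) <-> ideal_gen (h @` I) 1.

(* u is a universal element identifying the subfunctor U with Sp A *)
Definition represents F (U : forall A, F A -> Prop) (A : kalg) (u : F A) : Prop :=
  (forall (B : kalg) (h : khom A B), U B (fmap h u)) /\
  forall (B : kalg) (y : F B), U B y -> exists! h : khom A B, fmap h u = y.

Definition affine_open F (U : forall A, F A -> Prop) (A : kalg) (u : F A) : Prop :=
  open_subfunctor U /\ represents U u.

(* a family of open subfunctors covers F as soon as it does so on fields *)
Definition covers F (I : Type) (U : I -> forall A, F A -> Prop) : Prop :=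
  forall (K : fieldType) (s : {rmorphism k -> K}) (x : F (KAlg s)),
    exists i, U i (KAlg s) x.

Definition zariski_sheaf F : Prop :=
  forall (A : kalg) (n : nat) (f : 'I_n -> A),
    ideal_gen (range f) 1 ->
  forall (B : 'I_n -> kalg) (r : forall i, khom A (B i)),
    (forall i, is_localization (powers (f i)) (r i)) ->
  forall (C : 'I_n -> 'I_n -> kalg) (r1 : forall i j, khom (B i) (C i j))
         (r2 : forall i j, khom (B j) (C i j)),
    (forall i j, is_localization (powers (f i * f j))
                   (khom_comp (r1 i j) (r i))) ->
    (forall i j, khom_comp (r1 i j) (r i) =1 khom_comp (r2 i j) (r j)) ->
  forall x : forall i, F (B i),
    (forall i j, fmap (r1 i j) (x i) = fmap (r2 i j) (x j)) ->
  exists! y : F A, forall i, fmap (r i) y = x i.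

Definition is_scheme F : Prop :=
  zariski_sheaf F /\
  exists (I : Type) (U : I -> forall A, F A -> Prop),
    covers U /\ forall i, exists (A : kalg) (u : F A), affine_open (U i) u.

(* the diagonal F -> F x F is a closed immersion *)
Definition separated F : Prop :=
  forall (A : kalg) (x y : F A), exists2 I : set A, ideal I &
    forall (B : kalg) (h : khom A B),
      fmap h x = fmap h y <-> (forall a, I a -> h a = 0).

Definition finite_type F : Prop :=
  exists (n : nat) (U : 'I_n -> forall A, F A -> Prop),
    covers U /\ forall i, exists (A : kalg) (u : F A),
      affine_open (U i) u /\ finitely_generated A.

(* R is (isomorphic to) the local ring of F at some point *)
Definition is_stalk F (R : comPzRingType) : Prop :=
  exists (U : forall A, F A -> Prop) (A : kalg) (u : F A) (P : set A)
         (h : {rmorphism A -> R}),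
    [/\ affine_open U u, prime_ideal P & is_localization (~` P) h].

Definition reduced F : Prop := forall R, is_stalk F R -> reduced_ring R.

Definition regular F : Prop := forall R, is_stalk F R -> regular_local_ring R.

Definition variety F : Prop :=
  [/\ is_scheme F, reduced F, separated F & finite_type F].

(* The points of the underlying space |F| are represented by elements of F(K)
   for fields K over k.  Two representatives define the same point when they
   become equal over a common extension; the sets [closed_set] below are
   invariant under this relation, so no quotient is taken. *)
Record point F := Point {
  pt_field : fieldType;
  pt_str : {rmorphism k -> pt_field};
  pt_val : F (KAlg pt_str) }.

Definition closed_set F (Z : point F -> Prop) : Prop :=
  exists2 U : forall A, F A -> Prop, open_subfunctor U &
    forall p, Z p <-> ~ U (KAlg (pt_str p)) (pt_val p).

Definition irreducible F : Prop :=
  (exists p : point F, True) /\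
  forall Z1 Z2 : point F -> Prop, closed_set Z1 -> closed_set Z2 ->
    (forall p, Z1 p \/ Z2 p) -> (forall p, Z1 p) \/ (forall p, Z2 p).

(* L_n(F)(A) = F(A[t]/(t^(n+1))), since for Z = Spec A the product
   Z x Spec Z[t]/(t^(n+1)) is Spec A[t]/(t^(n+1)) *)
Section Jets.
Variables (n : nat) (F : kfunctor).

Let obj (A : kalg) := F (tpoly_alg n A).
Let map (A B : kalg) (h : khom A B) : obj A -> obj B := fmap (tpoly_hom n h).

Fact jet_map_id (A : kalg) (h : khom A A) (x : obj A) : h =1 id -> map h x = x.
Proof. by move=> e; apply: fmap_id => f; apply/ffunP => i; rewrite ffunE e. Qed.

Fact jet_map_comp (A B C : kalg) (h : khom A B) (g : khom B C) (x : obj A) :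
  map (khom_comp g h) x = map g (map h x).
Proof.
rewrite /map -fmap_comp; congr fmap; apply: khom_ext => f.
by apply/ffunP => i; rewrite !ffunE.
Qed.

Definition jet_scheme : kfunctor := KFunctor jet_map_id jet_map_comp.

End Jets.

Definition jet_trunc (n : nat) F (A : kalg) :
    jet_scheme n.+1 F A -> jet_scheme n F A := fmap (trunc_hom n A).

Fact jet_trunc_nat (n : nat) F (A B : kalg) (h : khom A B)
    (x : jet_scheme n.+1 F A) :
  jet_trunc (fmap h x) = fmap h (jet_trunc x).
Proof.
rewrite /jet_trunc /= -!fmap_comp; congr fmap; apply: khom_ext => f.
by apply/ffunP => i; rewrite !ffunE.
Qed.

Section Arcs.
Variable F : kfunctor.

Let obj (A : kalg) := {x : forall n, jet_scheme n F A |
  forall n, jet_trunc (x n.+1) = x n}.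

Fact arc_map_subproof (A B : kalg) (h : khom A B) (x : obj A) n :
  jet_trunc (fmap h (sval x n.+1)) = fmap h (sval x n).
Proof. by rewrite jet_trunc_nat (svalP x). Qed.

Let map (A B : kalg) (h : khom A B) (x : obj A) : obj B :=
  exist _ (fun n => fmap h (sval x n)) (arc_map_subproof h x).

Fact arc_map_id (A : kalg) (h : khom A A) (x : obj A) : h =1 id -> map h x = x.
Proof.
move=> e; case: x => x hx; apply: eq_exist.
by apply: functional_extensionality_dep => n; apply: fmap_id.
Qed.

Fact arc_map_comp (A B C : kalg) (h : khom A B) (g : khom B C) (x : obj A) :
  map (khom_comp g h) x = map g (map h x).
Proof.
by apply: eq_exist; apply: functional_extensionality_dep => n; apply: fmap_comp.
Qed.

Definition arc_scheme : kfunctor := KFunctor arc_map_id arc_map_comp.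

End Arcs.

End KAlgebras.

(* Main.v *)
Require Import Defs.
From HB Require Import structures.
From mathcomp Require Import all_boot all_order all_algebra all_field.
From mathcomp Require Import ring.
From mathcomp Require Import boolp classical_sets.

Set Implicit Arguments.
Unset Strict Implicit.
Unset Printing Implicit Defensive.

Import GRing.Theory.
Local Open Scope classical_set_scope.
Local Open Scope ring_scope.

(** Let [f] be an irreducible inseparable polynomial over [k], so that [f' = 0]
    and [k] has some characteristic [p > 0], and let [X] be the affine surface
    [f(x) = y^p z].

    [X] is integral and regular. Where [y] is invertible, [z] can be eliminated
    and [X] is an open part of the plane. At [y = 0] the coordinate ring modulo
    [y] is [K[z]] for the field [K = k[x] / (f)], hence [y] is prime and every
    prime ideal containing [y] is generated by [y] and at most one more
    element. In both cases the maximal ideal of the local ring is generated by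
    an element [pi], zero or prime, and one further element
    ([surface_generators_away], [surface_generators_special]). For such a
    Noetherian local domain regularity is elementary: all nonmaximal primes are
    principal ([regular_local_two_generators]), which bounds the dimension
    without general dimension theory. Noetherianity is Hilbert's basis theorem.

    The arc scheme is reducible because differentiating [f(x(t)) = y(t)^p z(t)]
    gives [y(t)^p z'(t) = 0]: an arc lies in the curve [y = 0] or satisfies
    [z'(t) = 0], so the closed sets [z_1 = 0] and [y_0 = y_1 = ... = 0] cover
    the arc scheme ([surface_arc]). Neither is everything: over [K] there is
    the arc [(alpha, 0, t)] with [alpha] a root of [f], and there are constant
    arcs with [y] nonzero.

    In terms of functors, [X] is [B |-> Hom(A, B)] for the coordinate ring [A],
    realized as the subring generated by [x], [y] and [f(x) / y^p] in the field
    [k(x, y)]. The sheaf property is the gluing of regular functions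
    ([localization_glue]), and the local rings of [X], though defined by
    arbitrary affine open subfunctors, are localizations of [A] ([spec_stalk]). *)

(** * Ideals and Noetherian rings *)

Section Ideals.
Variable R : comPzRingType.
Implicit Types (I J N : set R) (x y : R).

Lemma ideal0 I : ideal I -> I 0. Proof. by case. Qed.

Lemma idealD I x y : ideal I -> I x -> I y -> I (x + y).
Proof. by case=> _ h _; apply: h. Qed.

Lemma ideal_mull I a x : ideal I -> I x -> I (a * x).
Proof. by case=> _ _; apply. Qed.

Lemma ideal_mulr I a x : ideal I -> I x -> I (x * a).
Proof. by rewrite mulrC; apply: ideal_mull. Qed.

Lemma idealN I x : ideal I -> I x -> I (- x).
Proof. by move=> iI; rewrite -mulN1r; apply: ideal_mull. Qed.

Lemma idealB I x y : ideal I -> I x -> I y -> I (x - y).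
Proof. by move=> iI Ix Iy; apply: idealD => //; apply: idealN. Qed.

Lemma ideal_sum I (T : Type) (r : seq T) (P : pred T) (F : T -> R) :
  ideal I -> (forall i, P i -> I (F i)) -> I (\sum_(i <- r | P i) F i).
Proof.
move=> iI IF; apply: (big_ind I) => //; first exact: ideal0.
by move=> x y; apply: idealD.
Qed.

Lemma ideal_gen_sub (S : set R) : S `<=` ideal_gen S.
Proof.
move=> x Sx; exists 1%N, (fun=> 1), (fun=> x).
by split=> //; rewrite big_ord1 mul1r.
Qed.

Lemma ideal_gen_min (S I : set R) : ideal I -> S `<=` I -> ideal_gen S `<=` I.
Proof.
move=> iI SI _ [n [a [s [Ss ->]]]].
by apply: ideal_sum => // i _; apply: ideal_mull => //; apply: SI.
Qed.

Lemma ideal_gen_ideal (S : set R) : ideal (ideal_gen S).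
Proof.
split=> [||a _ [n [b [s [Ss ->]]]]]; last first.
- exists n, (fun i => a * b i), s; split=> //.
  by rewrite mulr_sumr; apply: eq_bigr => i _; rewrite mulrA.
- move=> _ _ [n [a [s [Ss ->]]]] [m [b [t [St ->]]]].
  pose glue (T : Type) (f : 'I_n -> T) (g : 'I_m -> T) (i : 'I_(n + m)) :=
    match split i with inl j => f j | inr j => g j end.
  exists (n + m)%N, (glue _ a b), (glue _ s t); split.
    by move=> i; rewrite /glue; case: (split i).
  rewrite big_split_ord /glue; congr (_ + _); apply: eq_bigr => i _.
    by case: split (unsplitK (inl i : 'I_n + 'I_m)) => j // [->].
  by case: split (unsplitK (inr i : 'I_n + 'I_m)) => j // [->].
exists 0%N, (fun=> 0), (fun=> 0); split; first by case.
by rewrite big_ord0.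
Qed.

Lemma ideal_genS (S T : set R) : S `<=` T -> ideal_gen S `<=` ideal_gen T.
Proof.
move=> ST; apply: ideal_gen_min; first exact: ideal_gen_ideal.
by move=> x /ST; apply: ideal_gen_sub.
Qed.

Lemma ideal_gen_range n (s : 'I_n -> R) x :
  ideal_gen (range s) x <-> exists a : 'I_n -> R, x = \sum_i a i * s i.
Proof.
split=> [|[a ->]]; last first.
  apply: ideal_sum => [|i _]; first exact: ideal_gen_ideal.
  by apply: ideal_mull; [exact: ideal_gen_ideal|apply: ideal_gen_sub; exists i].
move: x; apply: ideal_gen_min; last first.
  move=> _ [i _ <-]; exists (fun j => (j == i)%:R).
  rewrite (bigD1 i) //= eqxx mul1r big1 ?addr0 // => j /negPf ->.
  by rewrite mul0r.
split=> [||c _ [a ->]].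
- by exists (fun=> 0); rewrite big1 // => i _; rewrite mul0r.
- move=> _ _ [a ->] [b ->]; exists (fun i => a i + b i).
  by rewrite -big_split; apply: eq_bigr => i _; rewrite mulrDl.
exists (fun i => c * a i); rewrite mulr_sumr.
by apply: eq_bigr => i _; rewrite mulrA.
Qed.

Lemma ideal_gen_unit (I : set R) u : is_unit u -> ideal I -> I u -> I 1.
Proof. by move=> [v <-] iI Iu; apply: ideal_mulr. Qed.

Lemma is_unitM x y : is_unit x -> is_unit y -> is_unit (x * y).
Proof.
by move=> [x' xE] [y' yE]; exists (x' * y'); rewrite mulrACA xE yE mulr1.
Qed.

Lemma is_unit_mull x y : is_unit (x * y) -> is_unit x.
Proof. by move=> [z xyz]; exists (y * z); rewrite mulrA. Qed.

Lemma is_unit_cancel u x y : is_unit u -> x * u = y * u -> x = y.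
Proof.
by move=> [v uv] e; rewrite -[x]mulr1 -[y]mulr1 -uv !mulrA e.
Qed.

Lemma zero_ideal : ideal [set 0 : R].
Proof.
split=> [|x y /= -> ->|a x /= ->] //=; first by rewrite addr0.
by rewrite mulr0.
Qed.

Definition multiple x : set R := [set y | exists z, y = x * z].

Lemma multiple_ideal x : ideal (multiple x).
Proof.
split=> [||a _ [z ->]].
- by exists 0; rewrite mulr0.
- by move=> _ _ [y ->] [z ->]; exists (y + z); rewrite mulrDr.
by exists (a * z); rewrite mulrCA.
Qed.

Lemma multiple_refl x : multiple x x.
Proof. by exists 1; rewrite mulr1. Qed.

Lemma multiple_min I x : ideal I -> I x -> multiple x `<=` I.
Proof. by move=> iI Ix _ [z ->]; apply: ideal_mulr. Qed.

(** Induction on the number of generators of [P] modulo [N], as in the proof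
    of Nakayama's lemma: the last generator [s] satisfies a relation
    [(1 - x * c) * s] in the ideal generated by [N] and the other ones, and
    [1 - x * c] is a unit. *)
Lemma nakayama (P N : set R) x :
  (forall c, is_unit (1 - x * c)) -> noetherian R ->
  ideal P -> ideal N -> N `<=` P ->
  (forall u, P u -> exists2 v, P v & N (u - x * v)) -> P `<=` N.
Proof.
move=> xJ noeth iP iN NP PN.
have [n [s Ps]] := noeth P iP.
have {Ps}: exists2 s : 'I_n -> R, (forall i, P (s i)) &
    forall u, P u -> exists a, N (u - \sum_i a i * s i).
  exists s => [i|u]; first by rewrite Ps; apply: ideal_gen_sub; exists i.
  rewrite {1}Ps => /ideal_gen_range[a ->]; exists a; rewrite subrr.
  exact: ideal0.
elim: n {s} => [|n IH] [s Ps gs].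
  by move=> u /gs[a]; rewrite big_ord0 subr0.
apply: IH; exists (fun i => s (widen_ord (leqnSn n) i)) => // u Pu.
have [a Na] := gs u Pu.
have [v Pv Nv] := PN _ (Ps ord_max).
have [b Nb] := gs v Pv.
rewrite !big_ord_recr /= in Na Nb.
set A := (\sum_(i < n) _) in Na; set B := (\sum_(i < n) _) in Nb.
set z := s ord_max in Na Nv Nb.
have [c cE] := xJ (b ord_max).
exists (fun i => a (widen_ord (leqnSn n) i) +
   a ord_max * c * x * b (widen_ord (leqnSn n) i)).
have -> : \sum_(i < n) (a (widen_ord (leqnSn n) i) +
    a ord_max * c * x * b (widen_ord (leqnSn n) i)) *
      s (widen_ord (leqnSn n) i) = A + a ord_max * c * x * B.
  rewrite /A /B mulr_sumr -big_split; apply: eq_bigr => i _ /=.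
  by rewrite mulrDl !mulrA.
have -> : u - (A + a ord_max * c * x * B) =
    (u - (A + a ord_max * z)) + a ord_max * c * (z - x * v) +
    a ord_max * c * x * (v - (B + b ord_max * z)) -
    a ord_max * z * (1 * ((1 - x * b ord_max) * c - 1)) by ring.
rewrite cE subrr !mulr0 subr0.
apply: idealD => //; last exact: ideal_mull.
by apply: idealD => //; apply: ideal_mull.
Qed.

End Ideals.

Lemma ideal_preimage (A R : comPzRingType) (g : {rmorphism A -> R})
    (I : set R) : ideal I -> ideal (g @^-1` I).
Proof.
move=> iI; split=> [|x y|a x] /=; rewrite ?rmorph0 ?rmorphD ?rmorphM.
- exact: ideal0.
- exact: idealD.
- exact: ideal_mull.
Qed.

Lemma ideal_gen_morph (A R : comPzRingType) (g : {rmorphism A -> R})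
    (S : set A) (T : set R) :
  (forall a, S a -> ideal_gen T (g a)) ->
  forall a, ideal_gen S a -> ideal_gen T (g a).
Proof.
move=> ST; apply: (ideal_gen_min (I := g @^-1` ideal_gen T)) => //.
by apply: ideal_preimage; apply: ideal_gen_ideal.
Qed.

Lemma noetherian_fractions (A R : comPzRingType) (g : {rmorphism A -> R}) :
  (forall b, exists a s, is_unit (g s) /\ b * g s = g a) ->
  noetherian A -> noetherian R.
Proof.
move=> gfrac nA I iI.
have iJ := ideal_preimage g iI.
have [n [s Js]] := nA _ iJ.
exists n, (g \o s); apply/seteqP; split=> [b Ib|]; last first.
  apply: ideal_gen_min => // _ [i _ <-].
  by have : (g @^-1` I) (s i) by rewrite Js; apply: ideal_gen_sub; exists i.
have [a [t [[t' tt'] bt]]] := gfrac b.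
have : (g @^-1` I) a by rewrite /preimage /mkset -bt; apply: ideal_mulr.
rewrite Js => /ideal_gen_range[c aE].
have -> : b = t' * g a by rewrite -bt mulrCA [t' * _]mulrC tt' mulr1.
apply: ideal_mull; first exact: ideal_gen_ideal.
apply/ideal_gen_range; exists (g \o c); rewrite aE rmorph_sum.
by apply: eq_bigr => i _; rewrite rmorphM.
Qed.

Lemma ideal_gen_field (K : fieldType) (S : set K) :
  ideal_gen S 1 <-> exists2 c, S c & c != 0.
Proof.
split=> [S1|[c Sc c0]]; last first.
  apply: (ideal_gen_unit (u := c)); first by exists c^-1; rewrite divff.
    exact: ideal_gen_ideal.
  exact: ideal_gen_sub.
apply: contrapT => none; suff /eqP : (1 : K) = 0 by rewrite oner_eq0.
apply: (ideal_gen_min (I := [set (0 : K)]) _ _ S1) => [|c Sc].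
  exact: zero_ideal.
by apply: contrapT => /eqP c0; apply: none; exists c.
Qed.

Lemma noetherian_field (k : fieldType) : noetherian k.
Proof.
move=> I iI; have [[x [Ix x0]]|none] := pselect (exists x, I x /\ x != 0).
  exists 1%N, (fun=> 1); apply/seteqP; split=> y _.
    rewrite -[y]mulr1; apply: ideal_mull; first exact: ideal_gen_ideal.
    by apply: ideal_gen_sub; exists ord0.
  by rewrite -[y](divfK x0); apply: ideal_mull.
exists 0%N, (fun=> 0); apply/seteqP; split=> y.
  move=> Iy; have -> : y = 0.
    by apply/eqP/negP => /negP y0; case: none; exists y.
  by apply: ideal0; apply: ideal_gen_ideal.
by apply: (ideal_gen_min iI) => x [[m ltm] _ _]; rewrite ltn0 in ltm.
Qed.

(** The ascending chain condition, in the form used by Hilbert's basis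
    theorem. *)
Lemma noetherian_seq (R : comPzRingType) (h : nat -> R) :
  noetherian R -> exists N (c : 'I_N -> R), h N = \sum_(i < N) c i * h i.
Proof.
move=> nR; pose J N := ideal_gen (range (fun i : 'I_N => h i)).
have JS N N' : (N <= N')%N -> J N `<=` J N'.
  move=> le; apply: ideal_genS => _ [i _ <-].
  by exists (widen_ord le i).
have iJ N : ideal (J N) by apply: ideal_gen_ideal.
have iU : ideal (\bigcup_N J N).
  split=> [|x y [N _ Nx] [N' _ Ny]|a x [N _ Nx]].
  - by exists 0%N => //; apply: ideal0.
  - exists (maxn N N') => //; apply: idealD => //.
      by apply: JS Nx; apply: leq_maxl.
    by apply: JS Ny; apply: leq_maxr.
  - by exists N => //; apply: ideal_mull.
have [m [t Ut]] := nR _ iU.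
have /choice[N JN] : forall j, exists N, J N (t j).
  move=> j; have [N _ ?] : (\bigcup_N J N) (t j); last by exists N.
  by rewrite Ut; apply: ideal_gen_sub; exists j.
pose M := \max_j N j.
have : (\bigcup_N J N) (h M).
  by exists M.+1 => //; apply: ideal_gen_sub; exists ord_max.
rewrite Ut => UM; exists M; apply/ideal_gen_range.
suff : ideal_gen (range t) `<=` J M by apply.
by apply: ideal_gen_min => // _ [j _ <-]; apply: JS (JN j); apply: leq_bigmax.
Qed.

(** Hilbert's basis theorem.  If an ideal [I] were not finitely generated, one
    could choose successively in [I] elements [f n] of minimal degree outside
    the ideal generated by the previous ones; a relation between their leading
    coefficients would then produce an element of smaller degree. *)
Lemma hilbert_basis (R : comNzRingType) : noetherian R -> noetherian {poly R}.
Proof.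
move=> nR I iI; apply: contrapT => nfg.
pose gen (s : seq {poly R}) := ideal_gen [set` s].
have igen s : ideal (gen s) by apply: ideal_gen_ideal.
pose new s x := [/\ I x, ~ gen s x &
  forall y, I y -> ~ gen s y -> (size x <= size y)%N].
have newP (s : seq {poly R}) : {x | [set` s] `<=` I -> new s x}.
  apply: cid; have [sI|nsI] := pselect ([set` s] `<=` I); last by exists 0.
  have [x0 Ix0 gx0] : exists2 x, I x & ~ gen s x.
    apply: contrapT => no; apply: nfg.
    exists (size s), (fun i => s`_i).
    have -> : range (fun i : 'I_(size s) => s`_i) = [set` s].
      apply/seteqP; split=> [_ [i _ <-]|x /(nthP 0)[i lti <-]].
        exact: mem_nth.
      by exists (Ordinal lti).
    apply/seteqP; split=> [x Ix|]; last exact: ideal_gen_min.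
    by apply: contrapT => gx; apply: no; exists x.
  pose P n := `[< exists x, [/\ I x, ~ gen s x & size x = n] >].
  have exP : exists n, P n by exists (size x0); apply/asboolP; exists x0.
  case: (ex_minnP exP) => n /asboolP[x [Ix gx <-]] xmin.
  exists x => _; split=> // y Iy gy; apply: xmin.
  by apply/asboolP; exists y.
pose next s := sval (newP s).
pose S n := iter n (fun s => rcons s (next s)) [::].
pose f n := next (S n).
have SI n : [set` S n] `<=` I.
  elim: n => [|n IH] x /=; first by rewrite in_nil.
  rewrite mem_rcons inE => /orP[/eqP -> |]; last exact: IH.
  by have [] := svalP (newP (S n)) IH.
have fP n : new (S n) (f n) := svalP (newP (S n)) (@SI n).
have fS n i : (i < n)%N -> f i \in S n.
  elim: n => // n IH; rewrite ltnS leq_eqVlt /= mem_rcons inE.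
  by case/orP => [/eqP -> |/IH ->]; rewrite ?eqxx ?orbT.
have SS n i : (i <= n)%N -> {subset S i <= S n}.
  elim: n => [|n IH]; first by rewrite leqn0 => /eqP ->.
  rewrite leq_eqVlt => /orP[/eqP -> //|/IH h] x /h xS.
  by rewrite /= mem_rcons inE xS orbT.
have f0 n : f n != 0.
  apply/eqP => fn0; have [_ + _] := fP n; apply; rewrite fn0.
  exact: ideal0.
have szf n i : (i <= n)%N -> (size (f i) <= size (f n))%N.
  move=> le; have [_ _ +] := fP i; have [In gn _] := fP n.
  apply=> // gi; apply: gn; apply: ideal_genS gi => x; exact: SS.
have [N [c cE]] := noetherian_seq (fun n => lead_coef (f n)) nR.
pose d i := (size (f N) - size (f i))%N.
pose comb := \sum_(i < N) c i *: (f i * 'X^(d i)).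
pose H := f N - comb.
have [IN gN minN] := fP N.
have gH : gen (S N) comb.
  apply: ideal_sum => // i _; rewrite -mul_polyC; apply: ideal_mull => //.
  by apply: ideal_mulr => //; apply: ideal_gen_sub; apply: fS.
have IH : I H.
  apply: idealB => //; have := gH; apply: ideal_gen_min => //.
have nH : ~ gen (S N) H.
  by move=> gHH; apply: gN; rewrite -[f N](subrK comb); apply: idealD.
have := minN H IH nH; apply/negP; rewrite -ltnNge.
have szN : (0 < size (f N))%N by rewrite size_poly_gt0.
rewrite -[leqRHS](prednK szN) ltnS; apply/leq_sizeP => j lej.
rewrite /H /comb coefB coef_sum.
have coefE (i : 'I_N) : (c i *: (f i * 'X^(d i)))`_j =
    if j == (size (f N)).-1 then c i * lead_coef (f i) else 0.
  have sz0 : (0 < size (f i))%N by rewrite size_poly_gt0.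
  have sz1 : (size (f i) <= size (f N))%N by apply: szf; apply: ltnW.
  have dj : (d i <= j)%N.
    apply: leq_trans lej; rewrite /d -subn1; exact: leq_sub2l.
  rewrite coefZ coefMXn ltnNge dj /=; case: eqP => [->|/eqP ne].
    congr (_ * _); rewrite lead_coefE; congr (_`_ _).
    by rewrite /d -!subn1 subnAC subKn.
  rewrite nth_default ?mulr0 // /d leq_subRL //.
  rewrite subnK // -(prednK szN) ltn_neqAle eq_sym ne.
  exact: lej.
rewrite (eq_bigr _ (fun i _ => coefE i)).
case: eqP => [->|/eqP ne]; first by rewrite -lead_coefE cE subrr.
rewrite big1 // subr0 nth_default // -(prednK szN) ltn_neqAle eq_sym ne.
exact: lej.
Qed.

(** * Regular local rings of dimension at most two *)

Section RegularLocal.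
Variable R : comPzRingType.
Variables pi g : R.

Let M : set R := [set u | exists a b, u = pi * a + g * b].

Hypothesis R_noetherian : noetherian R.
Hypothesis R_domain : forall u v : R, u * v = 0 -> u = 0 \/ v = 0.
Hypothesis pi_prime : forall u v,
  multiple pi (u * v) -> multiple pi u \/ multiple pi v.
Hypothesis M_nonunit : forall u, M u <-> ~ is_unit u.

Let M_ideal : ideal M.
Proof.
split=> [|_ _ [a [b ->]] [c [d ->]]|x _ [a [b ->]]].
- by exists 0, 0; rewrite !mulr0 addr0.
- by exists (a + c), (b + d); ring.
by exists (x * a), (x * b); ring.
Qed.

Let M_pi : M pi. Proof. by exists 1, 0; ring. Qed.

Let M_g : M g. Proof. by exists 0, 1; ring. Qed.

Let M_not1 : ~ M 1.
Proof. by move=> /M_nonunit; apply; exists 1; rewrite mulr1. Qed.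

Let proper_sub_M I : ideal I -> ~ I 1 -> I `<=` M.
Proof.
by move=> iI I1 x Ix; apply/M_nonunit => ux; apply/I1/(ideal_gen_unit ux).
Qed.

Let prime_sub_M P : prime_ideal P -> P `<=` M.
Proof. by case=> iP P1 _; apply: proper_sub_M. Qed.

Let M_local : is_local_ring M.
Proof.
have Mmax : maximal_ideal M.
  split=> // I iI I1 MI; apply/seteqP; split=> //; exact: proper_sub_M.
by split=> // M' [iM' M'1 maxM']; apply/esym/maxM' => //; apply: proper_sub_M.
Qed.

Let M_prime : prime_ideal M.
Proof.
split=> // x y Mxy; apply: contrapT => /not_orP[nx ny].
move/M_nonunit: Mxy; apply; apply: is_unitM; apply: contrapT => nu.
  by apply/nx/M_nonunit.
by apply/ny/M_nonunit.
Qed.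

Let M_jacobson x c : M x -> is_unit (1 - x * c).
Proof.
move=> Mx; apply: contrapT => /M_nonunit M1; apply: M_not1.
by rewrite -(subrK (x * c) 1); apply: idealD => //; apply: ideal_mulr.
Qed.

Let zero_prime : prime_ideal [set 0 : R].
Proof.
split=> [|/= e|x y /R_domain //]; first exact: zero_ideal.
by apply: M_not1; rewrite e; apply: ideal0.
Qed.

(** If [f] is not in [P], then [P] inside the ideal of [f] means [P = f * P],
    so that [P = 0] by Nakayama's lemma. *)
Let prime_below_principal P f : prime_ideal P -> M f -> ~ P f ->
  P `<=` multiple f -> P `<=` [set 0].
Proof.
move=> [iP _ pP] Mf nf Pf.
apply: (@nakayama _ P _ f) => // [c||x /= ->|u Pu].
- exact: M_jacobson.
- exact: zero_ideal.
- exact: ideal0.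
have [v uE] := Pf u Pu; exists v; last by rewrite uE subrr.
by move: Pu; rewrite uE => /pP[].
Qed.

(** The powers of [g] tend to zero in the local ring [R / pi]. *)
Let krull_intersection u : ~ multiple pi g ->
  (forall m, exists a b, u = pi * a + g ^+ m * b) -> multiple pi u.
Proof.
move=> npg; pose D m u := exists a b, u = pi * a + g ^+ m * b.
have iD m : ideal (D m).
  split=> [|_ _ [a [b ->]] [c [d ->]]|x _ [a [b ->]]].
  - by exists 0, 0; rewrite !mulr0 addr0.
  - by exists (a + c), (b + d); ring.
  by exists (x * a), (x * b); ring.
apply: (@nakayama _ [set u | forall m, D m u] _ g) => // [c||||].
- exact: M_jacobson.
- split=> [|x y Dx Dy|a x Dx] m; first exact: ideal0.
    exact: idealD.
  exact: ideal_mull.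
- exact: multiple_ideal.
- by move=> _ [z ->] m; exists z, 0; rewrite mulr0 addr0.
move=> {}u Du; have [a [b uE]] := Du 1%N; rewrite expr1 in uE.
exists b; last by exists a; rewrite uE addrK.
move=> m; have [a' [b' uE']] := Du m.+1.
have [|//|[z bE]] := @pi_prime g (b - g ^+ m * b'); last first.
  by exists z, b'; rewrite -bE subrK.
exists (a' - a).
have -> : g * (b - g ^+ m * b') = (pi * a + g * b) -
    (pi * a' + g ^+ m.+1 * b') + pi * (a' - a) by rewrite exprS; ring.
by rewrite -uE -uE' subrr add0r.
Qed.

(** A prime [P] not containing [pi] has the same image in the discrete
    valuation ring [R / pi] as the ideal of an element [f] of [P] of minimal
    valuation; as [P] meets the ideal of [pi] in [pi * P], Nakayama's lemma
    shows that [f] generates [P]. *)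
Let prime_principal P : ~ multiple pi g -> prime_ideal P -> ~ (M `<=` P) ->
  exists2 f, P f & P `<=` multiple f.
Proof.
move=> npg pP nMP; have [iP P1 PM] := pP.
have [Ppi|nPpi] := pselect (P pi).
  have nPg : ~ P g.
    move=> Pg; apply: nMP => _ [a [b ->]].
    by apply: idealD => //; apply: ideal_mulr.
  exists pi => //; apply: (@nakayama _ P _ g) => // [c|||u Pu].
  - exact: M_jacobson.
  - exact: multiple_ideal.
  - exact: multiple_min.
  have [a [b uE]] := prime_sub_M pP Pu.
  exists b; last by exists a; rewrite uE addrK.
  have /PM[//|//] : P (g * b).
  rewrite (_ : g * b = u - pi * a); last by rewrite uE; ring.
  by apply: idealB => //; apply: ideal_mulr.
have [Psub|/existsNP[u0 /not_implyP[Pu0 nu0]]] := pselect (P `<=` multiple pi).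
  have P0 := prime_below_principal pP M_pi nPpi Psub.
  exists 0; first exact: ideal0.
  by move=> u /P0 ->; apply: multiple_refl.
pose D m u := exists a b, u = pi * a + g ^+ m * b.
pose val n := `[< exists u, P u /\ ~ D n.+1 u >].
have exval : exists n, val n.
  have [n nD] : exists n, ~ D n u0.
    apply: contrapT => no; apply: nu0; apply: krull_intersection => // m.
    by apply: contrapT => nD; apply: no; exists m.
  case: n nD => [[]|n nD]; first by exists 0, u0; rewrite mulr0 add0r mul1r.
  by exists n; apply/asboolP; exists u0.
case: (ex_minnP exval) => n /asboolP[f [Pf nDf]] minn.
have Dn u : P u -> D n u.
  move=> Pu; apply: contrapT => nD.
  case: n nD minn {nDf} => [[]|n nD minn].
    by exists 0, u; rewrite mulr0 add0r mul1r.
  have : val n by apply/asboolP; exists u.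
  by move=> /minn; rewrite ltnn.
have [a [b fE]] := Dn f Pf.
have [b' bb'] : is_unit b.
  apply: contrapT => /M_nonunit[c [d bE]]; apply: nDf.
  by exists (a + g ^+ n * c), d; rewrite fE bE exprS; ring.
exists f => //; apply: (@nakayama _ P _ pi) => // [c|||u Pu].
- exact: M_jacobson.
- exact: multiple_ideal.
- exact: multiple_min.
have [c [d uE]] := Dn u Pu.
have uE' : pi * (c - a * b' * d) = u - f * (b' * d).
  have -> : u - f * (b' * d) = pi * (c - a * b' * d) +
    g ^+ n * (d * (1 - b * b')) by rewrite uE fE; ring.
  by rewrite bb' subrr !mulr0 addr0.
exists (c - a * b' * d); last by exists (b' * d); rewrite uE'; ring.
have /PM[//|//] : P (pi * (c - a * b' * d)).
by rewrite uE'; apply: idealB => //; apply: ideal_mulr.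
Qed.

Let prime_step (P P' : set R) : prime_ideal P -> prime_ideal P' -> P `<` P' ->
  (exists2 f, P' f & P' `<=` multiple f) -> P `<=` [set 0].
Proof.
move=> pP pP' [PP' nP'P] [f P'f sub]; apply: (@prime_below_principal P f) => //.
- exact: prime_sub_M P'f.
- move=> Pf; apply: nP'P => u /sub; apply: multiple_min => //.
  by case: pP.
exact: subset_trans sub.
Qed.

Let not_proper0 (P P' : set R) : prime_ideal P -> P `<` P' -> ~ P' `<=` [set 0].
Proof.
by move=> [iP _ _] [_ n] P'0; apply: n => u /P'0 ->; apply: ideal0.
Qed.

(** The maximal ideal is generated by [pi] and [g], where [pi] is zero or prime;
    the dimension is the number of those generators which are needed. *)
Lemma regular_local_two_generators : regular_local_ring R.
Proof.
split=> //; have genM d (s : 'I_d -> R) : (forall i, M (s i)) ->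
    ideal_gen (range s) pi -> ideal_gen (range s) g -> M = ideal_gen (range s).
  move=> Ms spi sg; apply/seteqP; split=> [_ [a [b ->]]|].
    apply: idealD; first exact: ideal_gen_ideal.
      by apply: ideal_mulr => //; apply: ideal_gen_ideal.
    by apply: ideal_mulr => //; apply: ideal_gen_ideal.
  by apply: ideal_gen_min => // _ [i _ <-].
have genf d (s : 'I_d -> R) i : ideal_gen (range s) (s i).
  by apply: ideal_gen_sub; exists i.
have gen0 d (s : 'I_d -> R) : ideal_gen (range s) 0.
  by apply: ideal0; apply: ideal_gen_ideal.
have dim1 h : h <> 0 -> M = multiple h -> krull_dim R 1.
  move=> h0 Mh; split.
    exists (fun i => if i is 0 then [set 0] else M).
    split=> [[|i] //|[|i] // _].
    split=> [_ /= ->|]; first exact: ideal0.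
    by rewrite Mh => /(_ h (multiple_refl h)).
  move=> [P [Pp PS]].
  have [p0 p1 p2] := And3 (Pp 0%N isT) (Pp 1%N isT) (Pp 2%N isT).
  apply: (not_proper0 p0 (PS 0%N isT)).
  apply: (@prime_below_principal _ h) => //.
  - by rewrite Mh; apply: multiple_refl.
  - move=> P1h; have [_ n12] := PS 1%N isT; apply: n12 => u /(prime_sub_M p2).
    by rewrite Mh; apply: multiple_min => //; case: p1.
  - by rewrite -Mh; apply: prime_sub_M.
have M1 h : M h -> multiple h pi -> multiple h g -> M = multiple h.
  move=> Mh hpi hg; apply/seteqP; split; last exact: multiple_min.
  have ih := multiple_ideal h.
  by move=> _ [a [b ->]]; apply: idealD => //; apply: ideal_mulr.
exists M; have [pi0|pi0] := pselect (pi = 0).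
  have [g0|g0] := pselect (g = 0).
    have M0 : M = [set 0].
      apply/seteqP; split=> [_ [a [b ->]]|_ ->]; last exact: ideal0.
      by rewrite pi0 g0 !mul0r addr0.
    exists 0%N; split=> //; last first.
      exists (fun=> 0); apply: genM; rewrite ?pi0 ?g0 //.
      by case.
    split; first by exists (fun=> [set 0]); split.
    move=> [P [Pp PS]]; apply: (not_proper0 (Pp 0%N isT) (PS 0%N isT)).
    by rewrite -M0; apply/prime_sub_M/Pp.
  have Mg : M = multiple g.
    by apply: M1; rewrite ?pi0; [|apply: ideal0; apply: multiple_ideal|
      apply: multiple_refl].
  exists 1%N; split=> //; first exact: dim1 g0 Mg.
  exists (fun=> g); apply: genM; rewrite ?pi0 //.
  exact: (genf 1%N (fun=> g) ord0).
have [pg|npg] := pselect (multiple pi g).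
  have Mpi : M = multiple pi by apply: M1 => //; apply: multiple_refl.
  exists 1%N; split=> //; first exact: dim1 pi0 Mpi.
  exists (fun=> pi); apply: genM => //; first exact: (genf 1%N (fun=> pi) ord0).
  apply: multiple_min pg; first exact: ideal_gen_ideal.
  exact: (genf 1%N (fun=> pi) ord0).
exists 2%N; split=> //; last first.
  exists (fun i => if i == ord0 then pi else g); apply: genM => [i||].
  - by case: eqP.
  - exact: (genf 2%N (fun i => if i == ord0 then pi else g) ord0).
  - exact: (genf 2%N (fun i => if i == ord0 then pi else g) ord_max).
split.
  exists (fun i => if i is j.+1 then if j is 0 then multiple pi else M
                   else [set 0]).
  split=> [[|[|i]]|[|[|i]]] // _.
  - split; [exact: multiple_ideal| |exact: pi_prime].
    by move/(multiple_min M_ideal M_pi).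
  - split=> [_ /= ->|]; first by apply: ideal0; apply: multiple_ideal.
    by move=> /(_ pi (multiple_refl pi)).
  - split; first exact: multiple_min.
    by move=> /(_ g M_g).
move=> [P [Pp PS]].
have [p0 p1 p2 p3] :=
  And4 (Pp 0%N isT) (Pp 1%N isT) (Pp 2%N isT) (Pp 3%N isT).
apply: (not_proper0 p0 (PS 0%N isT)); apply: (prime_step p1 p2 (PS 1%N isT)).
apply: prime_principal => // MP2; have [_ n23] := PS 2%N isT; apply: n23.
by apply: subset_trans MP2; apply: prime_sub_M.
Qed.

End RegularLocal.

(** * Rings of fractions *)

Lemma prime_ideal_preimage (A B : comPzRingType) (h : {rmorphism A -> B})
    (P : set B) : prime_ideal P -> prime_ideal (h @^-1` P).
Proof.
move=> [iP P1 PM]; split=> [||a b]; first exact: ideal_preimage.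
  by rewrite /preimage /mkset rmorph1.
by rewrite /preimage /mkset rmorphM; apply: PM.
Qed.

Section Localization.
Variables (A B : comPzRingType) (S : set A) (h : {rmorphism A -> B}).
Hypothesis locS : is_localization S h.

Lemma localization_lift (R : comPzRingType) (g : {rmorphism A -> R}) :
  (forall s, S s -> is_unit (g s)) ->
  exists e : {rmorphism B -> R}, forall a, e (h a) = g a.
Proof.
have [_ hfrac hker] := locS; move=> gS.
have wd b a s a' s' : b * h s = h a -> b * h s' = h a' ->
    g a * g s' = g a' * g s.
  move=> e e'; have : h (a * s' - a' * s) = 0.
    by rewrite rmorphB !rmorphM -e -e' mulrAC subrr.
  move=> /hker[t St te]; apply: (is_unit_cancel (gS t St)).
  have /(congr1 g) := te; rewrite rmorph0 rmorphM rmorphB !rmorphM => gte.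
  by apply/eqP; rewrite -subr_eq0 -mulrBl mulrC gte.
have /choice[e eP] : forall b, exists v, forall a s,
    is_unit (g s) -> b * h s = h a -> v * g s = g a.
  move=> b; have [a [s [Ss bs]]] := hfrac b; have [t st] := gS s Ss.
  exists (g a * t) => a' s' us' bs'; apply: (is_unit_cancel (gS s Ss)).
  by rewrite -(wd _ _ _ _ _ bs bs') -[RHS]mulr1 -st; ring.
have eE b v a s : is_unit (g s) -> b * h s = h a -> v * g s = g a -> e b = v.
  by move=> us bs vs; apply: (is_unit_cancel us); rewrite vs; apply: eP.
have eadd : zmod_morphism e.
  move=> b b'; have [a [s [Ss bs]]] := hfrac b.
  have [a' [s' [Ss' bs']]] := hfrac b'.
  have [us us'] := (gS s Ss, gS s' Ss').
  apply: (@eE _ _ (a * s' - a' * s) (s * s')).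
  - by rewrite rmorphM; apply: is_unitM.
  - by rewrite rmorphB !rmorphM -bs -bs'; ring.
  - by rewrite rmorphB !rmorphM -(eP _ _ _ us bs) -(eP _ _ _ us' bs'); ring.
have emul : monoid_morphism e.
  split=> [|b b'].
    apply: (@eE _ _ 1 1); rewrite ?rmorph1 ?mulr1 //.
    by exists 1; rewrite mulr1.
  have [a [s [Ss bs]]] := hfrac b.
  have [a' [s' [Ss' bs']]] := hfrac b'.
  have [us us'] := (gS s Ss, gS s' Ss').
  apply: (@eE _ _ (a * a') (s * s')).
  - by rewrite rmorphM; apply: is_unitM.
  - by rewrite !rmorphM -bs -bs'; ring.
  - by rewrite !rmorphM -(eP _ _ _ us bs) -(eP _ _ _ us' bs'); ring.
pose e1 := GRing.isZmodMorphism.Build B R e eadd.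
pose e2 := GRing.isMonoidMorphism.Build B R e emul.
pose E : {rmorphism B -> R} := HB.pack e e1 e2.
exists E => a; apply: (@eE _ _ a 1); rewrite ?rmorph1 ?mulr1 //.
by exists 1; rewrite mulr1.
Qed.

End Localization.

Lemma localization_unit (A B : comPzRingType) (P : set A)
    (h : {rmorphism A -> B}) x :
  prime_ideal P -> is_localization (~` P) h -> is_unit (h x) -> ~ P x.
Proof.
move=> [iP P1 PM] [_ hfrac hker] [y xy] Px.
have [a [s [Ps ys]]] := hfrac y.
have : h (x * a - s) = 0 by rewrite rmorphB rmorphM -ys mulrA xy mul1r subrr.
move=> /hker[t Pt te]; suff /PM[] : P (t * s) by [].
rewrite (_ : t * s = t * (x * a) - t * (x * a - s)); last by ring.
by rewrite te subr0; apply: ideal_mull => //; apply: ideal_mulr.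
Qed.

Record subring (L : comPzRingType) := Subring {
  subring_set :> L -> Prop;
  subring_set1 : subring_set 1;
  subring_setB : forall x y,
    subring_set x -> subring_set y -> subring_set (x - y);
  subring_setM : forall x y,
    subring_set x -> subring_set y -> subring_set (x * y) }.

Section SubringType.
Variables (L : comPzRingType) (S : subring L).

Definition subring_pred (x : L) : bool := `[< S x >].

Fact subring_pred_closed : subring_closed subring_pred.
Proof.
split=> [|x y /asboolP Sx /asboolP Sy|x y /asboolP Sx /asboolP Sy];
  apply/asboolP; [exact: subring_set1|exact: subring_setB|exact: subring_setM].
Qed.

Definition subring_type := {x : L | subring_pred x}.

HB.instance Definition _ := SubChoice.on subring_type.
HB.instance Definition _ := GRing.SubChoice_isSubComPzRing.Build L subring_pred
  subring_type subring_pred_closed.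

Definition subring_elt x (Sx : S x) : subring_type := exist _ x (asboolT Sx).

Lemma subring_valP (u : subring_type) : S (val u).
Proof. by case: u => x Sx /=; apply/asboolP. Qed.

Section Corestriction.
Variables (A : comPzRingType) (f : {rmorphism A -> L}).
Hypothesis fS : forall a, S (f a).

Definition subring_cores (a : A) : subring_type := subring_elt (fS a).

Fact subring_cores_zmod : zmod_morphism subring_cores.
Proof. by move=> a b; apply: val_inj; rewrite rmorphB /= rmorphB. Qed.

Fact subring_cores_monoid : monoid_morphism subring_cores.
Proof.
split=> [|a b]; apply: val_inj; first by rewrite rmorph1 /= rmorph1.
by rewrite rmorphM /= rmorphM.
Qed.

HB.instance Definition _ := GRing.isZmodMorphism.Build A subring_type
  subring_cores subring_cores_zmod.
HB.instance Definition _ := GRing.isMonoidMorphism.Build A subring_type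
  subring_cores subring_cores_monoid.

End Corestriction.
End SubringType.

(** As [A] embeds in a field [L], fractions can be taken inside [L]. *)
Lemma localization_exists (A : comPzRingType) (L : fieldType)
    (i : {rmorphism A -> L}) (P : set A) :
  injective i -> prime_ideal P ->
  exists (B : comPzRingType) (h : {rmorphism A -> B}),
    is_localization (~` P) h.
Proof.
move=> inj_i [iP P1 PM].
have PMn s t : ~ P s -> ~ P t -> ~ P (s * t) by move=> ns nt /PM[].
have i0 s : ~ P s -> i s != 0.
  move=> Ps; rewrite -(rmorph0 i) (inj_eq inj_i); apply/eqP => s0.
  by apply: Ps; rewrite s0; apply: ideal0.
pose F : set L := [set x | exists a s, ~ P s /\ x * i s = i a].
have FS a : F (i a) by exists a, 1; rewrite rmorph1 mulr1.
have F1 : F 1 by rewrite -(rmorph1 i).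
have FB x y : F x -> F y -> F (x - y).
  move=> [a [s [Ps xs]]] [b [t [Pt yt]]]; exists (a * t - b * s), (s * t).
  by split; [exact: PMn|rewrite rmorphB !rmorphM -xs -yt; ring].
have FM x y : F x -> F y -> F (x * y).
  move=> [a [s [Ps xs]]] [b [t [Pt yt]]]; exists (a * b), (s * t).
  by split; [exact: PMn|rewrite !rmorphM -xs -yt; ring].
pose B := Subring F1 FB FM.
have FS' : forall a, B (i a) := FS.
exists (subring_type B), (subring_cores FS').
split=> [s Ps|b|a].
- have Fs : B (i s)^-1.
    by exists 1, s; split=> //; rewrite mulVf ?rmorph1 // i0.
  exists (subring_elt Fs); apply: val_inj; rewrite rmorphM rmorph1 /=.
  by rewrite divff // i0.
- have [a [s [Ps bs]]] := subring_valP b.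
  by exists a, s; split=> //; apply: val_inj; rewrite rmorphM.
- move=> /(congr1 val); rewrite [RHS]rmorph0 /= -(rmorph0 i) => /inj_i ->.
  by exists 1; rewrite ?mulr0.
Qed.

(** * Affine schemes *)

Section Spec.
Variable k : fieldType.
Implicit Types A B : kalg k.

Definition spec A : kfunctor k.
refine (@KFunctor k (fun B => khom A B) (fun B C h x => khom_comp h x) _ _).
- by move=> B h x hid; apply: khom_ext => a /=; rewrite hid.
- by move=> B C D h g x; apply: khom_ext.
Defined.

Definition khom_id A : khom A A := @KHom k A A idfun (fun c => erefl).

Lemma spec_affine_open A :
  @affine_open k (spec A) (fun _ _ => True) A (khom_id A).
Proof.
split; last first.
  split=> // B y _; exists y; split=> [|h <-]; exact: khom_ext.
split=> // B x; exists setT; first by split.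
move=> C h; split=> // _; apply: ideal_gen_sub; exists 1 => //.
exact: rmorph1.
Qed.

Lemma spec_separated A : separated (spec A).
Proof.
move=> B x y; exists (ideal_gen (range (fun a => x a - y a))).
  exact: ideal_gen_ideal.
move=> C h; split=> [e b|e]; last first.
  apply: khom_ext => a /=; apply/eqP; rewrite -subr_eq0 -rmorphB.
  by apply/eqP/e; apply: ideal_gen_sub; exists a.
have ik : ideal [set b | h b = 0].
  split=> [|c d /= c0 d0|c d /= d0]; first exact: rmorph0.
    by rewrite rmorphD c0 d0 addr0.
  by rewrite rmorphM d0 mulr0.
apply: (ideal_gen_min ik) => _ [a _ <-] /=.
have /= ea := congr1 (fun f : khom A C => f a) e.
by rewrite rmorphB ea subrr.
Qed.

Lemma spec_finite_type A : finitely_generated A -> finite_type (spec A).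
Proof.
move=> fgA; exists 1%N, (fun _ _ _ => True); split.
  by move=> *; exists ord0.
by move=> _; exists A, (khom_id A); split=> //; apply: spec_affine_open.
Qed.

(** The radical of the second ideal is an ideal containing every [f i]. *)
Lemma ideal_gen_exp (R : comPzRingType) n (f : 'I_n -> R) N :
  ideal_gen (range f) 1 -> ideal_gen (range (fun i => f i ^+ N)) 1.
Proof.
set J := ideal_gen (range (fun i => f i ^+ N)) => f1.
have iJ : ideal J by apply: ideal_gen_ideal.
pose rad : set R := [set x | exists m, J (x ^+ m)].
have irad : ideal rad.
  split=> [|x y [m xm] [l yl]|a x [m xm]].
  - by exists 1%N; rewrite expr1; apply: ideal0.
  - exists (m + l)%N; rewrite exprDn; apply: ideal_sum => // i _.
    rewrite -mulr_natr; apply: ideal_mulr => //.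
    have [le|lt] := leqP l i.
      by rewrite -(subnK le) exprD mulrA; apply: ideal_mull.
    rewrite -addnBA; last exact: ltnW.
    by rewrite exprD mulrAC; apply: ideal_mulr => //; apply: ideal_mulr.
  by exists m; rewrite exprMn; apply: ideal_mull.
have [m] : rad 1; last by rewrite expr1n.
apply: ideal_gen_min f1 => // _ [i _ <-].
by exists N; apply: ideal_gen_sub; exists i.
Qed.

(** Regular functions on the principal open sets of a covering which agree on
    the intersections glue.  After enlarging denominators, [b i] is
    [a i / f i ^+ N] with [a i * f j ^+ N = a j * f i ^+ N] in the ring itself;
    a relation [1 = \sum_j c j * f j ^+ N] then gives the glued function
    [\sum_j c j * a j]. *)
Lemma localization_glue (A : comPzRingType) n (f : 'I_n -> A)
    (B : 'I_n -> comPzRingType) (r : forall i, {rmorphism A -> B i})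
    (C : 'I_n -> 'I_n -> comPzRingType)
    (r1 : forall i j, {rmorphism B i -> C i j})
    (r2 : forall i j, {rmorphism B j -> C i j})
    (q : forall i j, {rmorphism A -> C i j}) :
  ideal_gen (range f) 1 ->
  (forall i, is_localization (powers (f i)) (r i)) ->
  (forall i j, is_localization (powers (f i * f j)) (q i j)) ->
  (forall i j a, r1 i j (r i a) = q i j a) ->
  (forall i j a, r2 i j (r j a) = q i j a) ->
  forall b : forall i, B i, (forall i j, r1 i j (b i) = r2 i j (b j)) ->
  exists! a, forall i, r i a = b i.
Proof.
move=> f1 rl ql e1 e2 b be.
have ur i m : is_unit (r i (f i ^+ m)).
  by have [u _ _] := rl i; apply: u; exists m.
have r0 (a : A) : (forall i, r i a = 0) -> a = 0.
  move=> ra; have /choice[m fm] : forall i, exists m, f i ^+ m * a = 0.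
    move=> i; have [_ _ z] := rl i.
    by have [_ [m _ <-] <-] := z a (ra i); exists m.
  pose M := \max_i m i.
  have /ideal_gen_range[c c1] := ideal_gen_exp M f1.
  rewrite -[a]mul1r c1 mulr_suml big1 // => i _.
  have le : (m i <= M)%N by apply: leq_bigmax.
  by rewrite -(subnK le) exprD -!mulrA fm !mulr0.
have /choice[a0 /choice[m a0E]] :
    forall i, exists a m, b i * r i (f i ^+ m) = r i a.
  move=> i; have [_ fr _] := rl i.
  by have [a [_ [[m _ <-] ?]]] := fr (b i); exists a, m.
pose M := \max_i m i.
have leM i : (m i <= M)%N by apply: leq_bigmax.
pose a1 i := a0 i * f i ^+ (M - m i).
have a1E i : b i * r i (f i ^+ M) = r i (a1 i).
  by rewrite -[in LHS](subnK (leM i)) addnC exprD !rmorphM mulrA a0E.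
have /choice[d dE] : forall i, exists d : 'I_n -> nat, forall j,
    (f i * f j) ^+ d j * (a1 i * f j ^+ M - a1 j * f i ^+ M) = 0.
  move=> i.
  have ij j : exists d,
      (f i * f j) ^+ d * (a1 i * f j ^+ M - a1 j * f i ^+ M) = 0; last first.
    by have [d dE] := choice ij; exists d.
  have [_ _ z] := ql i j.
  suff /z[_ [d _ <-] <-] : q i j (a1 i * f j ^+ M - a1 j * f i ^+ M) = 0.
    by exists d.
  have qi : q i j (a1 i) = r2 i j (b j) * q i j (f i ^+ M).
    by rewrite -e1 -a1E rmorphM e1 be.
  have qj : q i j (a1 j) = r2 i j (b j) * q i j (f j ^+ M).
    by rewrite -e2 -a1E rmorphM e2.
  by rewrite rmorphB [in X in X - _]rmorphM [in X in _ - X]rmorphM qi qj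
    mulrAC subrr.
pose e := \max_i \max_j d i j.
have eE i j : (f i * f j) ^+ e * (a1 i * f j ^+ M - a1 j * f i ^+ M) = 0.
  have le : (d i j <= e)%N.
    by apply: leq_trans (leq_bigmax i); apply: leq_bigmax.
  by rewrite -(subnK le) exprD -mulrA dE mulr0.
pose N := (M + e)%N; pose a i := a1 i * f i ^+ e.
have aE i : b i * r i (f i ^+ N) = r i (a i).
  by rewrite exprD [in LHS]rmorphM mulrA a1E -rmorphM.
have aC i j : a i * f j ^+ N = a j * f i ^+ N.
  apply/eqP; rewrite -subr_eq0 -(eE i j) /a /N !exprD exprMn; apply/eqP.
  ring.
have /ideal_gen_range[c c1] := ideal_gen_exp N f1.
clearbody a; have glued i : r i (\sum_j c j * a j) = b i.
  apply: (is_unit_cancel (ur i N)); rewrite -rmorphM aE; congr (r i _).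
  rewrite mulr_suml -[RHS]mul1r c1 mulr_suml; apply: eq_bigr => j _.
  by rewrite -!mulrA [f j ^+ N * _]mulrC aC.
exists (\sum_j c j * a j); split=> // x xb.
apply/eqP; rewrite -subr_eq0; apply/eqP/r0 => i.
by rewrite rmorphB xb glued subrr.
Qed.

Lemma spec_sheaf A : zariski_sheaf (spec A).
Proof.
move=> D n f f1 B r rl C r1 r2 ql rr x xx.
have glue (b : forall i, B i) : (forall i j, r1 i j (b i) = r2 i j (b j)) ->
    exists! d, forall i, r i d = b i.
  apply: (localization_glue f1 rl ql) => // i j d.
  exact/esym/(rr i j d).
have xa a i j : r1 i j (x i a) = r2 i j (x j a).
  by have /= := congr1 (fun h : khom A (C i j) => h a) (xx i j).
have /choice[y yE] : forall a, exists d, forall i, r i d = x i a.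
  by move=> a; have [d [dx _]] := glue (fun i => x i a) (xa a); exists d.
have yu a d : (forall i, r i d = x i a) -> y a = d.
  move=> dx; have [d' [_ d'u]] := glue (fun i => x i a) (xa a).
  by rewrite -(d'u _ dx) -(d'u _ (yE a)).
have yz : zmod_morphism y.
  by move=> a b; apply: yu => i; rewrite !rmorphB !yE.
have ym : monoid_morphism y.
  by split=> [|a b]; apply: yu => i; rewrite ?rmorph1 ?rmorphM ?yE.
pose y1 := GRing.isZmodMorphism.Build A D y yz.
pose y2 := GRing.isMonoidMorphism.Build A D y ym.
pose Y : {rmorphism A -> D} := HB.pack y y1 y2.
have Ys c : Y (kalg_str A c) = kalg_str D c.
  by apply: yu => i; rewrite !khom_str.
exists (KHom Ys); split=> [i|h hx]; apply: khom_ext => a /=; first exact: yE.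
by apply: yu => i; rewrite -hx.
Qed.

Lemma spec_scheme A : is_scheme (spec A).
Proof.
split; first exact: spec_sheaf.
exists 'I_1, (fun _ _ _ => True); split; first by move=> *; exists ord0.
by move=> _; exists A, (khom_id A); apply: spec_affine_open.
Qed.

(** If the affine open [U] is represented by [A'] and [h : A' -> R] is the local
    ring at [P], then [U] contains the spectrum of the localization [B] of [A] at
    the preimage [Q] of [P], which gives a map [psi : A' -> B]; by uniqueness in
    the universal property of [A'], the map [h] factors through [psi].  So
    fractions over [A'] are fractions over [A]. *)
Lemma spec_stalk A (L : fieldType) (inc : {rmorphism A -> L}) R :
  injective inc -> is_stalk (spec A) R ->
  exists (Q : set A) (g : {rmorphism A -> R}),
    prime_ideal Q /\ is_localization (~` Q) g.
Proof.
move=> inj_inc [U [A' [u [P [h [[[Usub Uopen] [Uu urep]] pP locP]]]]]].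
have [iP P1 PM] := pP; have [hunit hfrac hker] := locP.
pose phi : {rmorphism A -> A'} := khom_fun u.
pose Q := phi @^-1` P.
have pQ : prime_ideal Q by apply: prime_ideal_preimage.
have QM s t : ~ Q s -> ~ Q t -> ~ Q (s * t).
  by have [_ _ QM] := pQ => ns nt /QM[].
exists Q, (h \o phi : {rmorphism A -> R}); split=> //.
have [I iI UI] := Uopen A (khom_id A).
have [f If Qf] : exists2 f, I f & ~ Q f.
  apply: contrapT => IQ; apply: P1.
  have uE : @fmap k (spec A) _ _ (khom_id A') u =
      @fmap k (spec A) A A' u (khom_id A) by exact: khom_ext.
  have := Uu A' (khom_id A'); rewrite uE => /UI.
  apply: ideal_gen_min => // _ [a Ia <-].
  by apply: contrapT => nPa; apply: IQ; exists a.
have [B0 [loc locQ]] := localization_exists inj_inc pQ.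
have [locunit locfrac locker] := locQ.
pose B := KAlg (loc \o kalg_str A : {rmorphism k -> B0}).
pose locB : khom A B := @KHom k A B loc (fun c => erefl).
have UB : U B locB.
  have -> : locB = @fmap k (spec A) A B locB (khom_id A) by exact: khom_ext.
  apply/UI; have iJ := ideal_gen_ideal (locB @` I).
  apply: (ideal_gen_unit (locunit f Qf)) => //.
  by apply: ideal_gen_sub; exists f.
have [psi [psiu _]] := urep B locB UB.
have psiE a : psi (phi a) = loc a.
  by have := congr1 (fun g : khom A B => g a) psiu.
have nPunit s : ~ Q s -> is_unit (h (phi s)) by move=> Qs; apply: hunit.
have [ext extE] := localization_lift locQ (g := h \o phi) nPunit.
pose RA := KAlg (h \o kalg_str A' : {rmorphism k -> R}).
pose hR : khom A' RA := @KHom k A' RA h (fun c => erefl).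
have exts c : (ext \o psi) (kalg_str A' c) = kalg_str RA c.
  by rewrite /= khom_str /= extE /= khom_str.
pose eR : khom A' RA := @KHom k A' RA (ext \o psi : {rmorphism A' -> R}) exts.
have hE a : h a = ext (psi a).
  have [g [_ gu]] := urep RA (fmap hR u) (Uu RA hR).
  suff : hR = eR by move/(congr1 (fun g : khom A' RA => g a)).
  rewrite -(gu hR) // -(gu eR) //; apply: khom_ext => b /=.
  by rewrite psiE extE.
have frac a' : exists a s, ~ Q s /\ psi a' * loc s = loc a.
  exact: locfrac.
have hfrac' a' a s : psi a' * loc s = loc a -> h a' * h (phi s) = h (phi a).
  by move=> e; rewrite !hE !psiE -rmorphM e.
have notQ c s t : ~ P s -> ~ Q t -> psi s * loc t = loc c -> ~ Q c.
  move=> Ps Qt e; apply: (localization_unit pP locP).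
  by rewrite -(hfrac' _ _ _ e); apply: is_unitM; [exact: hunit|exact: nPunit].
split=> [s Qs|b|a].
- exact: nPunit.
- have [a' [s' [Ps' bE]]] := hfrac b.
  have [[c [t [Qt e]]] [c' [t' [Qt' e']]]] := (frac a', frac s').
  exists (c * t'), (c' * t); split; first by apply: QM => //; apply: notQ e'.
  by rewrite /= !rmorphM -(hfrac' _ _ _ e) -(hfrac' _ _ _ e') -bE; ring.
- move=> /= /hker[s Ps se]; have [c [t [Qt e]]] := frac s.
  have /locker[t' Qt' t'E] : loc (c * a) = 0.
    rewrite rmorphM -e mulrAC -[X in X * _](_ : psi (s * phi a) = _).
      by rewrite se rmorph0 mul0r.
    by rewrite rmorphM psiE.
  exists (t' * c); last by rewrite -mulrA.
  by apply: QM => //; apply: notQ e.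
Qed.

Lemma spec_irreducible A (L : fieldType) (inc : {rmorphism A -> L}) :
  injective inc -> irreducible (spec A).
Proof.
move=> inj_inc; pose s : {rmorphism k -> L} := inc \o kalg_str A.
pose eta : khom A (KAlg s) := @KHom k A (KAlg s) inc (fun c => erefl).
split; first by exists (@Point k (spec A) L s eta).
move=> Z1 Z2 [U1 U1o Z1E] [U2 U2o Z2E] cov.
(* A nonempty open subset contains the generic point [eta]. *)
have generic (U : forall B, spec A B -> Prop) (p : Defs.point (spec A)) :
    open_subfunctor U -> U _ (pt_val p) -> U _ eta.
  move=> [_ Uo] Up; have [I iI UI] := Uo A (khom_id A).
  have Ee (B : kalg k) (x : khom A B) : x = @fmap k (spec A) A B x (khom_id A).
    exact: khom_ext.
  have /ideal_gen_field[_ [f If <-] f0] : ideal_gen (pt_val p @` I) 1.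
    by apply/UI; rewrite -Ee.
  rewrite (Ee _ eta); apply/UI/ideal_gen_field.
  exists (inc f); first by exists f.
  rewrite -(rmorph0 inc) (inj_eq inj_inc); apply: contra_neq f0 => ->.
  exact: rmorph0.
apply: contrapT => /not_orP[/existsNP[p1 n1] /existsNP[p2 n2]].
have u1 : U1 _ (pt_val p1) by apply: contrapT => n; apply/n1/Z1E.
have u2 : U2 _ (pt_val p2) by apply: contrapT => n; apply/n2/Z2E.
have [/Z1E|/Z2E] := cov (@Point k (spec A) L s eta); apply.
  exact: generic u1.
exact: generic u2.
Qed.

End Spec.

(** * Polynomials *)

Lemma size_sub_cancel (R : comNzRingType) (u v : {poly R}) : u != 0 ->
  (size v <= size u)%N -> v`_(size u).-1 = lead_coef u ->
  (size (u - v)%R < size u)%N.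
Proof.
rewrite -size_poly_gt0 => u0 vu e.
rewrite -[ltnRHS](prednK u0) ltnS; apply/leq_sizeP => j.
rewrite leq_eqVlt => /orP[/eqP <-|lt]; first by rewrite coefB e subrr.
rewrite (prednK u0) in lt.
by rewrite coefB !nth_default ?subrr // (leq_trans vu).
Qed.

Lemma multiple_dvdp (k : fieldType) (q e : {poly k}) :
  multiple q e <-> q %| e.
Proof.
split=> [[r ->]|/dvdpP[r ->]]; first exact: dvdp_mulr.
by exists r; rewrite mulrC.
Qed.

Lemma dvd_Xn (R : comNzRingType) n (c : {poly R}) :
  (forall i, (i < n)%N -> c`_i = 0) -> multiple 'X^n c.
Proof.
move=> c0; exists (drop_poly n c).
suff t0 : take_poly n c = 0 by rewrite -{1}(poly_take_drop n c) t0 add0r mulrC.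
by apply/polyP => i; rewrite coef_take_poly coef0; case: ltnP => // /c0.
Qed.

Lemma dvd_Xn_mulC (R : idomainType) n (c : {poly R}) g :
  g != 0 -> multiple 'X^n (c * g%:P) -> multiple 'X^n c.
Proof.
move=> g0 [d cE]; apply: dvd_Xn => i lt.
have := congr1 (fun q : {poly R} => q`_i) cE.
rewrite /= coefMC coefXnM lt => /eqP.
by rewrite mulf_eq0 (negbTE g0) orbF => /eqP.
Qed.

Lemma inseparable_irreducible (k : fieldType) : ~ perfect_field k ->
  exists f : {poly k}, irreducible_poly f /\ f^`() = 0.
Proof.
move/existsNP => [f /not_implyP[f_irr f_insep]]; exists f; split=> //.
move/negP: f_insep.
rewrite separable_poly.unlock irreducible_poly_coprime // negbK.
move=> f_df; apply/eqP/negPn/negP => df0; have := dvdp_leq df0 f_df.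
have f0 : f != 0 by rewrite -size_poly_gt0; case: f_irr => /ltnW.
by rewrite leqNgt lt_size_deriv.
Qed.

Lemma pchar_deriv0 (k : fieldType) (f : {poly k}) :
  (1 < size f)%N -> f^`() = 0 -> exists p, p \in [pchar k].
Proof.
case sz : (size f) => [|[|n]] // _ df0; apply: (@natf0_pchar _ n.+1) => //.
have : f`_n.+1 * n.+1%:R == 0 by rewrite mulr_natr -coef_deriv df0 coef0.
rewrite mulf_eq0 => /orP[f0|//].
by have := lead_coef_eq0 f; rewrite lead_coefE -size_poly_eq0 sz f0.
Qed.

Lemma adjoin_root (k : fieldType) (q : {poly k}) : irreducible_poly q ->
  exists (K : fieldType) (s : {rmorphism k -> K}) (alpha : K),
    forall e, (map_poly s e).[alpha] = 0 <-> multiple q e.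
Proof.
move=> q_irr; have [K _ [alpha /rootP q0 _]] := irredp_FAdjoin q_irr.
exists K, (GRing.in_alg K), alpha => e; split=> [e0|[r ->]]; last first.
  by rewrite rmorphM hornerM q0 mul0r.
apply/multiple_dvdp/negPn; rewrite -irreducible_poly_coprime //.
apply/negP => /Bezout_eq1_coprimepP[[a b] /= ab].
have /eqP := congr1 (fun r => (map_poly (GRing.in_alg K) r).[alpha]) ab.
rewrite rmorphD !rmorphM rmorph1 hornerD !hornerM q0 e0 !mulr0 addr0 hornerC.
by rewrite eq_sym oner_eq0.
Qed.

Lemma poly_prime_ideal (k : fieldType) (J : set {poly k}) : prime_ideal J ->
  exists q, (q = 0 \/ irreducible_poly q) /\ forall e, J e <-> multiple q e.
Proof.
move=> [iJ J1 PJ].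
have [[e0 [Je0 e00]]|none] := pselect (exists e, J e /\ e != 0); last first.
  exists 0; split=> [|e]; first by left.
  split=> [Je|[r ->]]; last by rewrite mul0r; apply: ideal0.
  exists 0; rewrite mul0r; apply: contrapT => e0; apply: none; exists e.
  by split=> //; apply/eqP.
pose sz n := `[< exists e, [/\ J e, e != 0 & size e = n] >].
have exsz : exists n, sz n by exists (size e0); apply/asboolP; exists e0.
case: (ex_minnP exsz) => n /asboolP[q [Jq q0 <-]] minq.
have Jdvd e : J e <-> multiple q e.
  split=> [Je|]; last exact: multiple_min.
  apply/multiple_dvdp/eqP; apply: contrapT => /eqP r0.
  have := ltn_modp e q; rewrite q0 ltnNge => /negP; apply; apply: minq.
  apply/asboolP; exists (e %% q); split=> //.
  have -> : e %% q = e - e %/ q * q.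
    by rewrite [X in X - _](divp_eq e q) addrAC subrr add0r.
  by apply: idealB => //; apply: ideal_mull.
exists q; split=> //; right.
have qn1 : size q != 1%N.
  apply/negP => /size_poly1P[c c0 qE]; apply: J1; apply/Jdvd.
  by exists (c^-1)%:P; rewrite qE -polyCM mulfV.
split=> [|r r1 rq].
  by rewrite ltn_neqAle eq_sym qn1 size_poly_gt0.
have /dvdpP[t qE] := rq.
have qr0 : t * r != 0 by rewrite -qE.
have : J (t * r) by rewrite -qE.
move=> /PJ[Jt|Jr].
  have t0 : t != 0 by apply: contraNneq qr0 => ->; rewrite mul0r.
  have r0 : r != 0 by apply: contraNneq qr0 => ->; rewrite mulr0.
  have := dvdp_leq t0 (proj1 (multiple_dvdp _ _) (proj1 (Jdvd t) Jt)).
  rewrite {1}qE size_mul // => le; move: r1 r0; rewrite -size_poly_gt0.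
  move: le (size_poly_eq0 t); rewrite (negbTE t0).
  case: (size t) => // m; case: (size r) => [|[|l]] //.
  by rewrite !addnS /= addSn ltnNge leq_addr.
by rewrite /eqp rq; apply/multiple_dvdp/Jdvd.
Qed.

Lemma multiple_polyC (D E : idomainType) (rho : {rmorphism E -> D}) q :
  (forall e, rho e = 0 <-> multiple q e) ->
  forall c, map_poly rho c = 0 <-> multiple q%:P c.
Proof.
move=> rhoE c; split=> [c0|[r ->]]; last first.
  rewrite rmorphM /= map_polyC /= (proj2 (rhoE q)) ?mul0r //.
  exact: multiple_refl.
have /choice[r rE] : forall i, exists r, c`_i = q * r.
  by move=> i; apply/rhoE; rewrite -coef_map c0 coef0.
exists (\poly_(i < size c) r i); apply/polyP => i.
rewrite coefCM coef_poly; case: ltnP => [_|le]; first exact: rE.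
by rewrite mulr0 nth_default.
Qed.

(** For [q = 0] this is [k[x]] itself, and otherwise the field obtained by
    adjoining a root of [q]. *)
Lemma poly_quotient_domain (k : fieldType) (q : {poly k}) :
  q = 0 \/ irreducible_poly q ->
  exists (D : idomainType) (rho : {rmorphism {poly k} -> D}),
    forall e, rho e = 0 <-> multiple q e.
Proof.
move=> [->|/adjoin_root[K [s [alpha sE]]]].
  exists {poly k}, idfun => e; split=> [/= ->|[r ->]] /=; last by rewrite mul0r.
  by exists 0; rewrite mulr0.
by exists K, (horner_eval alpha \o map_poly s : {rmorphism {poly k} -> K}).
Qed.

(** Pseudo-division by an element [g] of minimal degree among those of [Q] with
    a coefficient outside [(q)]: its leading coefficient is not in [(q)]. *)
Lemma prime_two_generators (k : fieldType) (A : comPzRingType)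
    (j : {rmorphism {poly {poly k}} -> A}) (Q : set A) (q : {poly k}) :
  prime_ideal Q -> (forall e, Q (j e%:P) <-> multiple q e) ->
  exists2 g, Q (j g) & forall u, Q (j u) -> exists c v w,
    ~ Q (j c%:P) /\ c%:P * u = g * v + q%:P * w.
Proof.
move=> [iQ Q1 PQ] Qq.
have nQ1 : ~ Q (j 1%:P) by rewrite rmorph1.
have Qjq v : Q (j (q%:P * v)).
  by rewrite rmorphM; apply: ideal_mulr => //; apply/Qq/multiple_refl.
have [[g0 [Qg0 ng0]]|none] :=
    pselect (exists g, Q (j g) /\ ~ multiple q%:P g); last first.
  exists 0 => [|u Qu]; first by rewrite rmorph0; apply: ideal0.
  have [w uE] : multiple q%:P u.
    by apply: contrapT => nu; apply: none; exists u.
  by exists 1, 0, w; split=> //; rewrite mul1r mul0r add0r.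
pose sz n := `[< exists g, [/\ Q (j g), ~ multiple q%:P g & size g = n] >].
have exsz : exists n, sz n by exists (size g0); apply/asboolP; exists g0.
case: (ex_minnP exsz) => n /asboolP[g [Qg ng <-]] ming.
have g_n0 : g != 0.
  apply/eqP => g0'; apply: ng; rewrite g0'.
  by apply: ideal0; apply: multiple_ideal.
have minsz u : Q (j u) -> (size u < size g)%N -> multiple q%:P u.
  move=> Qu lt; apply: contrapT => nu; move: lt; apply/negP; rewrite -leqNgt.
  by apply: ming; apply/asboolP; exists u.
pose l := lead_coef g.
have nQl : ~ Q (j l%:P).
  move=> /Qq[r lE]; pose h := (q * r)%:P * 'X^((size g).-1).
  have mh : multiple q%:P h.
    by exists (r%:P * 'X^((size g).-1)); rewrite /h polyCM mulrA.
  apply: ng; rewrite -(subrK h g); apply: idealD; first exact: multiple_ideal.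
    apply: minsz.
      by rewrite rmorphB; apply: idealB => //; case: mh => w ->.
    apply: size_sub_cancel => //; last by rewrite coefCM coefXn eqxx mulr1 -lE.
    rewrite /h mul_polyC (leq_trans (size_scale_leq _ _)) // size_polyXn.
    by rewrite prednK ?size_poly_gt0.
  exact: mh.
exists g => // u; have [m] := ubnP (size u).
elim: m u => // m IH u; rewrite ltnS => um Qu.
have [[w uE]|nu] := pselect (multiple q%:P u).
  by exists 1, 0, w; split=> //; rewrite mul1r mulr0 add0r.
have gu : (size g <= size u)%N by rewrite leqNgt; apply/negP => /(minsz u Qu).
have l0 : l != 0 by rewrite lead_coef_eq0.
have u0 : u != 0 by rewrite -size_poly_gt0 (leq_trans _ gu) // size_poly_gt0.
pose t := (lead_coef u)%:P * 'X^(size u - size g).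
have t0 : t != 0.
  by rewrite mulf_neq0 ?polyC_eq0 ?lead_coef_eq0 // -size_poly_gt0 size_polyXn.
have szt : size (g * t) = size u.
  rewrite size_mul // /t size_Cmul ?lead_coef_eq0 // size_polyXn addnS /=.
  by rewrite subnKC.
have [||c [v [w [nQc cE]]]] := IH (l%:P * u - g * t).
- rewrite -(size_Cmul u l0) in um; apply: leq_trans um.
  apply: size_sub_cancel; rewrite ?mulf_neq0 ?polyC_eq0 //.
    by rewrite szt size_Cmul.
  rewrite size_Cmul // -szt -lead_coefE lead_coefM [RHS]lead_coefM lead_coefC.
  by rewrite /t lead_coefM lead_coefC lead_coefXn mulr1.
- by rewrite rmorphB !rmorphM; apply: idealB => //;
    [apply: ideal_mull|apply: ideal_mulr].
exists (c * l), (v + c%:P * t), w; split.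
  by rewrite polyCM rmorphM => /PQ[].
rewrite polyCM -mulrA -[l%:P * u](subrK (g * t)) mulrDr cE; ring.
Qed.

(** * The surface [f(x) = y^p z] *)

Lemma quotient_lift (T A R : comPzRingType) (e : {rmorphism T -> A})
    (g : {rmorphism T -> R}) :
  (forall a, exists t, e t = a) -> (forall t, e t = 0 -> g t = 0) ->
  exists h : {rmorphism A -> R}, forall t, h (e t) = g t.
Proof.
move=> surj ker.
have gE t t' : e t = e t' -> g t = g t'.
  move=> ett; apply/eqP; rewrite -subr_eq0 -rmorphB; apply/eqP/ker.
  by rewrite rmorphB ett subrr.
have [h0 hE] := choice surj.
have gh t : g (h0 (e t)) = g t by apply: gE; rewrite hE.
have hz : zmod_morphism (g \o h0).
  by move=> a b /=; rewrite -rmorphB; apply: gE; rewrite rmorphB !hE.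
have hm : monoid_morphism (g \o h0).
  split=> [|a b] /=; rewrite -?(rmorph1 g) -?rmorphM; apply: gE.
    by rewrite hE rmorph1.
  by rewrite rmorphM !hE.
pose h1 := GRing.isZmodMorphism.Build A R (g \o h0) hz.
pose h2 := GRing.isMonoidMorphism.Build A R (g \o h0) hm.
by exists (HB.pack (g \o h0) h1 h2 : {rmorphism A -> R}).
Qed.

Section Surface.
Variables (k : fieldType) (f : {poly k}) (p : nat).
Hypotheses (f_irr : irreducible_poly f) (p_gt0 : (0 < p)%N).

(** The function field is [k(x, y)]; the inner variable of [kxy] is [x]. *)
Notation kxy := {poly {poly k}}.
Notation L := {fraction kxy}.
Local Notation "c %:F" := (@FracField.tofrac kxy c).

Definition surface_z : L := (f%:P)%:F / ('X ^+ p)%:F.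

Definition surface_ev : {rmorphism {poly kxy} -> L} :=
  horner_eval surface_z \o map_poly (@FracField.tofrac kxy).

Fact surface_set1 : exists P, surface_ev P = 1.
Proof. by exists 1; rewrite rmorph1. Qed.

Fact surface_setB u v : (exists P, surface_ev P = u) ->
  (exists P, surface_ev P = v) -> exists P, surface_ev P = u - v.
Proof. by move=> [P <-] [P' <-]; exists (P - P'); rewrite rmorphB. Qed.

Fact surface_setM u v : (exists P, surface_ev P = u) ->
  (exists P, surface_ev P = v) -> exists P, surface_ev P = u * v.
Proof. by move=> [P <-] [P' <-]; exists (P * P'); rewrite rmorphM. Qed.

Definition surface_subring : subring L :=
  Subring surface_set1 surface_setB surface_setM.

Fact surface_ev_in P : surface_subring (surface_ev P).
Proof. by exists P. Qed.

(** The coordinate ring [k[x, y, f(x) / y^p]]. *)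
Notation A := (subring_type surface_subring).

Definition surface_pi : {rmorphism {poly kxy} -> A} :=
  subring_cores surface_ev_in.

Definition surface_inc : {rmorphism A -> L} := val.

Definition surface_j : {rmorphism kxy -> A} := surface_pi \o polyC.

Definition surface_alg : kalg k :=
  KAlg (surface_j \o polyC \o polyC : {rmorphism k -> A}).

Let x : A := surface_j 'X%:P.
Let y : A := surface_j 'X.
Let z : A := surface_pi 'X.

Lemma surface_pi_surj (u : A) : exists P, surface_pi P = u.
Proof.
have [P PE] := subring_valP u; exists P.
exact/val_inj.
Qed.

Lemma surface_inc_inj : injective surface_inc.
Proof. exact: val_inj. Qed.

Lemma surface_incE P : surface_inc (surface_pi P) = surface_ev P.
Proof. by []. Qed.

Lemma surface_inc_j c : surface_inc (surface_j c) = c%:F.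
Proof. by rewrite surface_incE /= map_polyC /horner_eval hornerC. Qed.

Lemma surface_j_inj : injective surface_j.
Proof.
move=> c d /(congr1 surface_inc); rewrite !surface_inc_j => /eqP.
by rewrite tofrac_eq => /eqP.
Qed.

Lemma surface_domain (u v : A) : u * v = 0 -> u = 0 \/ v = 0.
Proof.
move=> /(congr1 surface_inc)/eqP; rewrite rmorphM rmorph0 mulf_eq0.
by rewrite -!(rmorph0 surface_inc) !(inj_eq surface_inc_inj) =>
  /orP[/eqP|/eqP]; [left|right].
Qed.

Lemma surface_eq : surface_j f%:P = y ^+ p * z.
Proof.
apply: surface_inc_inj; rewrite rmorphM rmorphXn !surface_inc_j surface_incE.
rewrite /= map_polyX /horner_eval hornerX /surface_z tofracXn mulrC divfK //.
by rewrite expf_neq0 // tofrac_eq0 polyX_eq0.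
Qed.

Lemma surface_ind (P : A -> Prop) :
  (forall c, P (surface_j c)) -> P z -> (forall u v, P u -> P v -> P (u + v)) ->
  (forall u v, P u -> P v -> P (u * v)) -> forall u, P u.
Proof.
move=> Pj Pz PD PM u; have [F <-] := surface_pi_surj u.
elim/poly_ind: F => [|F c IH]; first by rewrite rmorph0 -(rmorph0 surface_j).
by rewrite rmorphD rmorphM; apply: PD (Pj c); apply: PM.
Qed.

Lemma surface_finitely_generated : finitely_generated surface_alg.
Proof.
exists 3%N, (tnth [tuple x; y; z]) => P Pk PD PM Pxyz.
have [Px Py Pz] := And3 (Pxyz ord0) (Pxyz (inord 1)) (Pxyz ord_max).
rewrite (tnth_nth 0) /= inordK // in Py.
apply: surface_ind => // c.
have P0 : P 0 by have := Pk 0; rewrite rmorph0.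
elim/poly_ind: c => [|c d IH]; first by rewrite rmorph0.
rewrite rmorphD rmorphM; apply: (PD); first exact: PM.
elim/poly_ind: d => [|d a IHd]; first by rewrite rmorph0.
rewrite rmorphD rmorphM rmorphD rmorphM; apply: (PD _ _ _ (Pk a)).
exact: PM.
Qed.

Lemma surface_noetherian : noetherian A.
Proof.
apply: (@noetherian_fractions _ _ surface_pi) => [u|].
  have [P PE] := surface_pi_surj u; exists P, 1; rewrite rmorph1 mulr1.
  by split=> //; exists 1; rewrite mulr1.
do 3!apply: hilbert_basis; exact: noetherian_field.
Qed.

(** Inverting [y] makes [z] superfluous. *)
Lemma surface_denominator (u : A) : exists n c, y ^+ n * u = surface_j c.
Proof.
elim/surface_ind: u => [c||u v [n [c uE]] [m [d vE]]|u v [n [c uE]] [m [d vE]]].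
- by exists 0%N, c; rewrite mul1r.
- by exists p, f%:P; rewrite surface_eq.
- exists (n + m)%N, (c * 'X^m + d * 'X^n).
  by rewrite rmorphD !rmorphM !rmorphXn -uE -vE exprD; ring.
- exists (n + m)%N, (c * d); rewrite rmorphM -uE -vE exprD; ring.
Qed.

(** The image is the subring generated by [x] and [z]. *)
Definition surface_jz : {rmorphism kxy -> A} :=
  surface_pi \o map_poly (@polyC {poly k}).

Lemma surface_jzC e : surface_jz e%:P = surface_j e%:P.
Proof. by rewrite /= map_polyC. Qed.

Lemma surface_mod_y (u : A) : exists w v, u = surface_jz w + y * v.
Proof.
elim/surface_ind: u => [c||u v [w [v1 ->]] [w' [v1' ->]]|
    u v [w [v1 ->]] [w' [v1' ->]]].
- elim/poly_ind: c => [|c d _].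
    by exists 0, 0; rewrite !rmorph0 mulr0 addr0.
  exists d%:P, (surface_j c).
  by rewrite surface_jzC rmorphD rmorphM mulrC addrC.
- by exists 'X, 0; rewrite /= map_polyX mulr0 addr0.
- by exists (w + w'), (v1 + v1'); rewrite rmorphD; ring.
- exists (w * w'), (surface_jz w * v1' + surface_jz w' * v1 + y * v1 * v1').
  by rewrite rmorphM; ring.
Qed.


Let F : {poly kxy} := ('X ^+ p)%:P * 'X - (f%:P)%:P.

Let surface_z_eq : surface_z * ('X ^+ p)%:F = (f%:P)%:F.
Proof. by rewrite divfK // tofrac_eq0 expf_neq0 // polyX_eq0. Qed.

Lemma surface_ev_eq : surface_ev F = 0.
Proof.
have evC c : surface_ev c%:P = c%:F.
  by rewrite /= map_polyC /horner_eval hornerC.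
have evX : surface_ev 'X = surface_z.
  by rewrite /= map_polyX /horner_eval hornerX.
by rewrite /F rmorphB rmorphM evX 2!evC mulrC surface_z_eq subrr.
Qed.

(** The leading coefficient of a polynomial in [z] of positive degree in the
    kernel is divisible by [y ^ p], as [f(x)] is prime to [y]; so its degree can
    be lowered by subtracting a multiple of the equation. *)
Lemma surface_kernel P : surface_ev P = 0 -> multiple F P.
Proof.
have [n] := ubnP (size P); elim: n P => // n IH P.
move=> szP P0; have [/size1_polyC PE|gt1] := leqP (size P) 1.
  move/eqP: P0; rewrite PE /= map_polyC /horner_eval hornerC tofrac_eq0.
  by move/eqP=> ->; rewrite polyC0; apply: ideal0; apply: multiple_ideal.
case: n IH szP => [|[|n]] IH szP; rewrite ltnS in szP.
- by move: (leq_trans gt1 szP).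
- by move: (leq_trans gt1 szP).
have : \sum_(i < n.+2) P`_i * (f%:P ^+ i * 'X^p ^+ (n.+1 - i)) = 0.
  apply/eqP; rewrite -tofrac_eq0 rmorph_sum; apply/eqP.
  have : surface_ev P * ('X^p)%:F ^+ n.+1 = 0 by rewrite P0 mul0r.
  rewrite /= /horner_eval (@horner_coef_wide _ n.+2); last first.
    by rewrite (leq_trans (size_poly _ _)).
  rewrite mulr_suml => {2}<-; apply: eq_bigr => i _.
  have le : (i <= n.+1)%N by rewrite -ltnS.
  rewrite coef_map /= !tofracM !tofracXn -surface_z_eq !tofracXn exprMn.
  have -> : ('X%:F ^+ p) ^+ n.+1 =
      ('X%:F ^+ p) ^+ i * ('X%:F ^+ p) ^+ (n.+1 - i) by rewrite -exprD subnKC.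
  by rewrite -!mulrA.
rewrite big_ord_recr /= subnn mulr1.
move=> /eqP; rewrite addrC addr_eq0 -rmorphXn => /eqP Pn.
have [d dE] : multiple 'X^p P`_n.+1.
  apply: (@dvd_Xn_mulC _ p _ (f ^+ n.+1)).
    by rewrite expf_neq0 // -size_poly_gt0; case: f_irr => /ltnW.
  rewrite Pn; apply: idealN; first exact: multiple_ideal.
  apply: ideal_sum; first exact: multiple_ideal.
  move=> i _; apply: ideal_mull; first exact: multiple_ideal.
  apply: ideal_mull; first exact: multiple_ideal.
  by rewrite subSn ?exprS -1?ltnS //; exists ('X^p ^+ (n - i)).
rewrite -(subrK (F * (d%:P * 'X^n)) P); apply: idealD.
- exact: multiple_ideal.
- apply: IH; last by rewrite rmorphB rmorphM P0 surface_ev_eq mul0r subr0.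
  rewrite ltnS; apply/leq_sizeP => i lei.
  have -> : F * (d%:P * 'X^n) =
      ('X^p * d)%:P * 'X^(n.+1) - (f%:P * d)%:P * 'X^n.
    by rewrite /F !polyCM exprS; ring.
  rewrite -dE !coefB !coefCM !coefXn [i == n]gtn_eqF // mulr0 subr0.
  case: eqP => [->|/eqP ne]; first by rewrite mulr1 subrr.
  by rewrite mulr0 subr0 nth_default // (leq_trans szP) // ltn_neqAle eq_sym ne.
- by exists (d%:P * 'X^n).
Qed.

Section SpecialFibre.
Variables (K : fieldType) (s : {rmorphism k -> K}) (alpha : K).
Hypothesis root_alpha : forall e, (map_poly s e).[alpha] = 0 <-> multiple f e.

Let theta0 : {rmorphism kxy -> K} :=
  horner_eval alpha \o map_poly s \o horner_eval 0.

(** The curve [y = 0] in the surface is the affine line with coordinate [z] over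
    [k[x] / (f)]. *)
Lemma surface_special_fibre : exists theta : {rmorphism A -> {poly K}},
  [/\ forall c, theta (surface_j c) = ((map_poly s c.[0]).[alpha])%:P,
      theta z = 'X & forall u, theta u = 0 <-> multiple y u].
Proof.
have FP : map_poly theta0 F = 0.
  rewrite rmorphB rmorphM /= map_polyX !map_polyC /= /horner_eval.
  rewrite hornerXn hornerC expr0n gtn_eqF // map_poly0 horner0 mul0r.
  by rewrite (proj2 (root_alpha f)) ?subr0 //; apply: multiple_refl.
have [|theta thetaE] :=
    quotient_lift (e := surface_pi) (g := map_poly theta0) surface_pi_surj.
  move=> P /(congr1 surface_inc); rewrite surface_incE rmorph0.
  by move=> /surface_kernel[S ->]; rewrite rmorphM /= FP mul0r.
have thetaj c : theta (surface_j c) = ((map_poly s c.[0]).[alpha])%:P.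
  by rewrite thetaE /= map_polyC.
exists theta; split=> // [|u]; first by rewrite thetaE /= map_polyX.
split=> [|[v ->]]; last first.
  by rewrite rmorphM thetaj hornerX map_poly0 horner0 mul0r.
have iy := multiple_ideal y.
have yj c : theta0 c = 0 -> multiple y (surface_j c).
  elim/poly_ind: c => [|c d _].
    by move=> _; rewrite rmorph0; exact: (ideal0 iy).
  have -> : theta0 (c * 'X + d%:P) = (map_poly s d).[alpha].
    by rewrite /= /horner_eval hornerMXaddC mulr0 add0r.
  move=> /root_alpha[e ->].
  rewrite rmorphD rmorphM; apply: (idealD iy).
    exact: (ideal_mull _ iy (multiple_refl _)).
  rewrite polyCM rmorphM surface_eq -(prednK p_gt0) exprS.
  by rewrite -!mulrA; exists (y ^+ p.-1 * (z * surface_j e%:P)).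
have [P <-] := surface_pi_surj u; rewrite thetaE => /= P0.
have {P0} : forall i, theta0 P`_i = 0 by move=> i; rewrite -coef_map P0 coef0.
elim/poly_ind: P => [_|P c IH Pi]; first by rewrite rmorph0; exact: (ideal0 iy).
rewrite rmorphD rmorphM; apply: (idealD iy).
  apply: (ideal_mulr _ iy); apply: IH => i.
  by have := Pi i.+1; rewrite coefD coefMX coefC addr0.
by apply: yj; have := Pi 0%N; rewrite coefD coefMX coefC add0r.
Qed.

End SpecialFibre.

End Surface.

(** * Regularity of the surface *)

Lemma prime_idealX (R : comPzRingType) (Q : set R) x n :
  prime_ideal Q -> ~ Q x -> ~ Q (x ^+ n).
Proof.
move=> [_ Q1 PQ] Qx; elim: n => [//|n IH].
by rewrite exprS => /PQ[].
Qed.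

Section LocalizationDomain.
Variables (A R : comPzRingType) (Q : set A) (h : {rmorphism A -> R}).
Hypothesis Q_prime : prime_ideal Q.
Hypothesis h_loc : is_localization (~` Q) h.
Hypothesis A_domain : forall u v : A, u * v = 0 -> u = 0 \/ v = 0.

Let h_unit s : ~ Q s -> is_unit (h s).
Proof. by have [u _ _] := h_loc => Qs; apply: u. Qed.

Let h_inj a b : h a = h b -> a = b.
Proof.
move=> e; have [_ _ ker] := h_loc; have [iQ _ _] := Q_prime.
have /ker[s Qs /A_domain[s0|/eqP]] : h (a - b) = 0 by rewrite rmorphB e subrr.
  by case: Qs; rewrite s0; apply: ideal0.
by rewrite subr_eq0 => /eqP.
Qed.

Lemma localization_domain (u v : R) : u * v = 0 -> u = 0 \/ v = 0.
Proof.
move=> uv; have [_ frac _] := h_loc.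
have [a [s [Qs ua]]] := frac u; have [b [t [Qt vb]]] := frac v.
have h0 w c r : ~ Q r -> w * h r = h c -> c = 0 -> w = 0.
  move=> Qr e c0; apply: (is_unit_cancel (h_unit Qr)).
  by rewrite e c0 rmorph0 mul0r.
have /A_domain[a0|b0] : a * b = 0.
  by apply: h_inj; rewrite rmorphM -ua -vb mulrACA uv mul0r rmorph0.
  by left; apply: h0 ua a0.
by right; apply: h0 vb b0.
Qed.

Lemma localization_noetherian : noetherian A -> noetherian R.
Proof.
apply: (@noetherian_fractions _ _ h) => b; have [_ frac _] := h_loc.
by have [a [s [Qs bs]]] := frac b; exists a, s; split=> //; apply: h_unit.
Qed.

(** As the elements outside [Q] become units in [R], the two conditions are only
    needed up to multiplication by such elements. *)
Lemma localization_regular x1 x2 : noetherian A -> Q x1 -> Q x2 ->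
  (forall u, Q u -> exists s v w, ~ Q s /\ s * u = x1 * v + x2 * w) ->
  (forall a b c, a * b = x1 * c ->
     exists2 s, ~ Q s & multiple x1 (s * a) \/ multiple x1 (s * b)) ->
  regular_local_ring R.
Proof.
move=> nA Qx1 Qx2 gen x1_prime; have [iQ Q1 PQ] := Q_prime.
have [_ frac _] := h_loc.
have mulu (x e u : R) : is_unit e -> multiple x (u * e) -> multiple x u.
  move=> [e' ee'] [v ve]; exists (v * e').
  by rewrite mulrA -ve -mulrA ee' mulr1.
apply: (@regular_local_two_generators R (h x1) (h x2)).
- exact: localization_noetherian.
- exact: localization_domain.
- move=> u v [w uvw]; have [a [s [Qs ua]]] := frac u.
  have [b [t [Qt vb]]] := frac v; have [c [r [Qr wc]]] := frac w.
  have : (a * r) * b = x1 * (c * s * t).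
    by apply: h_inj; rewrite !rmorphM -ua -vb -wc; transitivity
      (u * v * (h s * h r * h t)); [ring|rewrite uvw; ring].
  move=> /x1_prime[s' Qs' [[d de]|[d de]]]; [left|right].
    apply: (mulu _ (h (s * r * s'))).
      by rewrite !rmorphM; do !apply: is_unitM; apply: h_unit.
    exists (h d); rewrite -rmorphM -de !rmorphM -ua; ring.
  apply: (mulu _ (h (t * s'))).
    by rewrite !rmorphM; do !apply: is_unitM; apply: h_unit.
  exists (h d); rewrite -rmorphM -de !rmorphM -vb; ring.
move=> u; split=> [[v [w uE]] uu|nu].
  have [a [s [Qs va]]] := frac v; have [b [t [Qt wb]]] := frac w.
  have : Q (x1 * a * t + x2 * b * s).
    by apply: idealD => //; do !apply: ideal_mulr => //.
  apply: (localization_unit Q_prime h_loc).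
  rewrite (_ : h _ = u * (h s * h t)).
    by do !apply: is_unitM => //; apply: h_unit.
  by rewrite uE rmorphD !rmorphM -va -wb; ring.
have [a [s [Qs ua]]] := frac u.
have Qa : Q a.
  apply: contrapT => Qa; apply: nu; apply: (@is_unit_mull _ _ (h s)).
  by rewrite ua; apply: h_unit.
have [t [v [w [Qt tE]]]] := gen a Qa.
have [e st] : is_unit (h (s * t)).
  by rewrite rmorphM; apply: is_unitM; apply: h_unit.
exists (h v * e), (h w * e).
rewrite !mulrA -mulrDl -!rmorphM -rmorphD -tE rmorphM -ua.
by rewrite -[LHS]mulr1 -st rmorphM; ring.
Qed.

End LocalizationDomain.

Lemma domain_reduced (R : comPzRingType) :
  (forall u v : R, u * v = 0 -> u = 0 \/ v = 0) -> reduced_ring R.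
Proof.
move=> dom x; elim=> [x0|n IH]; first by rewrite -[x]mulr1 -(expr0 x) x0 mulr0.
by rewrite exprS => /dom[].
Qed.

Section SurfaceRegular.
Variables (k : fieldType) (f : {poly k}) (p : nat).
Hypotheses (f_irr : irreducible_poly f) (p_gt0 : (0 < p)%N).

Notation A := (subring_type (surface_subring f p)).
Notation j := (surface_j f p).
Let y : A := j 'X.

Variable Q : set A.
Hypothesis Q_prime : prime_ideal Q.

Let J : set {poly k} := [set e | Q (j e%:P)].

Let J_prime : prime_ideal J.
Proof. exact: (prime_ideal_preimage (j \o polyC) Q_prime). Qed.

(** Away from the curve [y = 0], the surface is the plane with coordinates [x]
    and [y]. *)
Lemma surface_generators_away : ~ Q y -> exists x1 x2, [/\ Q x1, Q x2,
  (forall u, Q u -> exists s v w, ~ Q s /\ s * u = x1 * v + x2 * w) &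
  (forall a b c, a * b = x1 * c ->
     exists2 s, ~ Q s & multiple x1 (s * a) \/ multiple x1 (s * b))].
Proof.
move=> Qy; have [iQ Q1 PQ] := Q_prime.
have Qyn n : ~ Q (y ^+ n) by apply: prime_idealX.
have [q [q_irr qE]] := poly_prime_ideal J_prime.
have [g Qg gE] := prime_two_generators Q_prime qE.
exists (j q%:P), (j g); split=> //.
- exact/(qE q)/multiple_refl.
- move=> u Qu; have [n [c ucE]] := surface_denominator u.
  have [|d [v [w [Qd dE]]]] := gE c; first by rewrite -ucE; apply: ideal_mull.
  exists (j d%:P * y ^+ n), (j w), (j v); split; first by move=> /PQ[|/Qyn].
  by rewrite -mulrA ucE -!rmorphM dE rmorphD addrC.
move=> a b c abE; have [n [a' aE]] := surface_denominator a.
have [m [b' bE]] := surface_denominator b.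
have [l [c' cE]] := surface_denominator c.
have E : 'X^l * a' * b' = q%:P * (c' * 'X^(n + m)).
  apply: (@surface_j_inj _ f p); rewrite !rmorphM !rmorphXn -aE -bE -cE.
  rewrite -/y exprD.
  transitivity (y ^+ l * y ^+ n * y ^+ m * (a * b)); first by ring.
  by rewrite abE; ring.
have [D [rho rhoE]] := poly_quotient_domain q_irr.
have rhoP := multiple_polyC rhoE.
have /eqP : map_poly rho ('X^l * a' * b') = 0.
  by apply/rhoP; exists (c' * 'X^(n + m)).
rewrite !rmorphM mulf_eq0 mulf_eq0 /= map_polyXn expf_eq0 polyX_eq0 andbF /=.
case/orP => /eqP/rhoP[r rE].
  exists (y ^+ n) => //; left; exists (j r).
  by rewrite aE rE rmorphM.
exists (y ^+ m) => //; right; exists (j r).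
by rewrite bE rE rmorphM.
Qed.

(** Modulo [y] the coordinate ring is [K[z]] for the field [K = k[x] / (f)]. *)
Lemma surface_generators_special : Q y -> exists x1 x2, [/\ Q x1, Q x2,
  (forall u, Q u -> exists s v w, ~ Q s /\ s * u = x1 * v + x2 * w) &
  (forall a b c, a * b = x1 * c ->
     exists2 s, ~ Q s & multiple x1 (s * a) \/ multiple x1 (s * b))].
Proof.
move=> Qy; have [iQ Q1 PQ] := Q_prime.
have [q [q_irr qE]] := poly_prime_ideal J_prime.
have Qqz e : Q (surface_jz f p e%:P) <-> multiple q e.
  by rewrite surface_jzC; apply: qE.
have [g Qg gE] := prime_two_generators Q_prime Qqz.
have yf : multiple y (j f%:P).
  have yp : y ^+ p = y * y ^+ p.-1 by rewrite -exprS prednK.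
  rewrite surface_eq // -/y yp -mulrA.
  by exists (y ^+ p.-1 * surface_pi f p 'X).
have /qE/multiple_dvdp qf : J f.
  by case: yf => r e; rewrite /J /mkset e; apply: ideal_mulr.
have f0 : f != 0 by rewrite -size_poly_gt0; case: f_irr => /ltnW.
have q1 : size q != 1%N.
  case: q_irr => [q0|[lt _]]; first by move: qf; rewrite q0 dvd0p (negbTE f0).
  by rewrite neq_ltn lt orbT.
have /andP[_ /multiple_dvdp[r rE]] := f_irr.2 q q1 qf.
have [t tE] : multiple y (j q%:P).
  rewrite rE polyCM rmorphM.
  by case: yf => v ->; exists (v * j r%:P); rewrite mulrA.
exists y, (surface_jz f p g); split=> //.
- move=> u Qu; have [w [v uE]] := surface_mod_y u.
  have Qw : Q (surface_jz f p w).
    rewrite -(addrK (y * v) (surface_jz f p w)) -uE.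
    by apply: idealB => //; apply: ideal_mulr.
  have [d [v' [w' [Qd dE]]]] := gE w Qw.
  exists (j d%:P), (t * surface_jz f p w' + j d%:P * v), (surface_jz f p v').
  split; first by rewrite -surface_jzC.
  rewrite uE mulrDr -[X in X * surface_jz f p w]surface_jzC -rmorphM dE.
  rewrite rmorphD !rmorphM surface_jzC tE -/y; ring.
- move=> a b c abE.
  have [K [s [alpha root_alpha]]] := adjoin_root f_irr.
  have [theta [_ _ thetaE]] := surface_special_fibre f_irr p_gt0 root_alpha.
  exists 1; rewrite // !mul1r.
  have /eqP : theta (a * b) = 0 by apply/thetaE; exists c.
  by rewrite rmorphM mulf_eq0 => /orP[]/eqP/thetaE; [left|right].
Qed.

End SurfaceRegular.

Lemma surface_stalk (k : fieldType) (f : {poly k}) p (R : comPzRingType) :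
  irreducible_poly f -> (0 < p)%N -> is_stalk (spec (surface_alg f p)) R ->
  regular_local_ring R /\ reduced_ring R.
Proof.
move=> f_irr p_gt0.
move=> /(@spec_stalk _ (surface_alg f p) {fraction {poly {poly k}}}
  (surface_inc f p) R (@surface_inc_inj _ f p)).
move=> [Q [h [Qp hloc]]].
have dom := @surface_domain _ f p.
split; last by apply: domain_reduced; exact: (localization_domain Qp hloc dom).
have [x1 [x2 [Q1 Q2 gen pr]]] : exists x1 x2, [/\ Q x1, Q x2,
  (forall u, Q u -> exists s v w, ~ Q s /\ s * u = x1 * v + x2 * w) &
  (forall a b c, a * b = x1 * c ->
     exists2 s, ~ Q s & multiple x1 (s * a) \/ multiple x1 (s * b))].
  have [Qy|Qy] := pselect (Q (surface_j f p 'X)).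
    exact: surface_generators_special.
  exact: surface_generators_away.
apply: (localization_regular Qp hloc dom _ Q1 Q2 gen pr).
exact: surface_noetherian.
Qed.

Lemma surface_variety (k : fieldType) (f : {poly k}) p :
  irreducible_poly f -> (0 < p)%N ->
  [/\ variety (spec (surface_alg f p)), regular (spec (surface_alg f p)) &
      irreducible (spec (surface_alg f p))].
Proof.
move=> f_irr p_gt0; split.
- split; [exact: spec_scheme| |exact: spec_separated|].
    by move=> R /(surface_stalk f_irr p_gt0)[].
  exact/spec_finite_type/surface_finitely_generated.
- by move=> R /(surface_stalk f_irr p_gt0)[].
- exact: (@spec_irreducible _ (surface_alg f p) {fraction {poly {poly k}}}
    (surface_inc f p) (@surface_inc_inj _ f p)).
Qed.

(** * Arcs *)

Section Reduction.
Variables (n : nat) (R : comNzRingType).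

(** Reduction modulo [t ^ n.+1] of polynomials in [t]. *)
Definition tpoly_of_poly (P : {poly R}) : tpoly n R :=
  [ffun i : 'I_n.+1 => P`_i].

Fact tpoly_of_poly_zmod : zmod_morphism tpoly_of_poly.
Proof. by move=> P P'; apply/ffunP => i; rewrite !ffunE coefB. Qed.

Fact tpoly_of_poly_monoid : monoid_morphism tpoly_of_poly.
Proof.
split=> [|P P']; apply/ffunP => i; rewrite !ffunE.
  by rewrite coef1 -val_eqE /=; case: eqP.
rewrite coefM (big_ord_widen n.+1 (fun j => P`_j * P'`_(i - j))) //.
rewrite big_mkcond; apply: eq_bigr => j _; rewrite ltnS; case: leqP => [le|lt].
  rewrite (big_pred1 (Ordinal (leq_ltn_trans (leq_subr j i) (ltn_ord i)))).
    by rewrite !ffunE.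
  by move=> l; rewrite -[RHS]val_eqE /= -[RHS](eqn_add2l j) subnKC.
by rewrite big_pred0 // => l; apply: gtn_eqF; rewrite ltn_addr.
Qed.

HB.instance Definition _ := GRing.isZmodMorphism.Build {poly R} (tpoly n R)
  tpoly_of_poly tpoly_of_poly_zmod.
HB.instance Definition _ := GRing.isMonoidMorphism.Build {poly R} (tpoly n R)
  tpoly_of_poly tpoly_of_poly_monoid.

Lemma tpoly_of_poly_surj u : exists P, tpoly_of_poly P = u.
Proof.
exists (\poly_(i < n.+1) u (inord i)); apply/ffunP => i.
by rewrite ffunE coef_poly ltn_ord inord_val.
Qed.

Lemma tpoly_of_polyC c : tpoly_of_poly c%:P = tpoly_const n c.
Proof. by apply/ffunP => i; rewrite !ffunE coefC -val_eqE. Qed.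

End Reduction.

Section Arcs.
Variables (k : fieldType) (A : kalg k).
Local Notation arc := (arc_scheme (spec A)).

Definition arc_jet (B : kalg k) (w : arc B) n : khom A (tpoly_alg n B) :=
  sval w n.

Definition arc_coef (B : kalg k) (w : arc B) (u : A) (m : nat) : B :=
  (arc_jet w m u : tpoly m B) ord_max.

Lemma arc_jetE B (w : arc B) n u (i : 'I_n.+1) :
  (arc_jet w n u : tpoly n B) i = arc_coef w u i.
Proof.
have step m (j : 'I_m.+1) : (arc_jet w m u : tpoly m B) j =
    (arc_jet w m.+1 u : tpoly m.+1 B) (widen_ord (leqnSn m.+1) j).
  have := congr1 (fun h : khom A (tpoly_alg m B) => (h u : tpoly m B) j)
    (svalP w m).
  by rewrite /= ffunE => <-.
elim: n i => [|n IH] i.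
  by rewrite ord1 /arc_coef; congr (_ _); apply: val_inj.
have [lt|ge] := ltnP i n.+1; last first.
  have e : i = n.+1 :> nat by apply/eqP; rewrite eqn_leq ge -ltnS ltn_ord.
  by rewrite /arc_coef; move: i {ge} e => [i lti] /= e; subst i; congr (_ _);
    apply: val_inj.
rewrite (_ : i = widen_ord (leqnSn n.+1) (Ordinal lt)); last exact: val_inj.
by rewrite -step IH.
Qed.

Lemma arc_coef_fmap (B C : kalg k) (h : khom B C) (w : arc B) u m :
  arc_coef (fmap h w) u m = h (arc_coef w u m).
Proof. by rewrite /arc_coef /= ffunE. Qed.

(** The complement is the open subfunctor where these coefficients generate
    the unit ideal. *)
Lemma arc_zeros_closed (T : Type) (u : T -> A) (m : T -> nat) :
  @closed_set k arc (fun q => forall t, arc_coef (pt_val q) (u t) (m t) = 0).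
Proof.
pose coefs (B : kalg k) (w : arc B) : set B :=
  range (fun t => arc_coef w (u t) (m t)).
have coefs_fmap (B C : kalg k) (h : khom B C) (w : arc B) t :
    coefs C (fmap h w) (h (arc_coef w (u t) (m t))).
  by exists t => //; rewrite arc_coef_fmap.
exists (fun B w => ideal_gen (coefs B w) 1); first split.
- move=> B C h w /(ideal_gen_morph (g := h) (T := coefs C (fmap h w))).
  rewrite rmorph1; apply=> _ [t _ <-]; apply: ideal_gen_sub.
  exact: coefs_fmap.
- move=> B w; exists (ideal_gen (coefs B w)); first exact: ideal_gen_ideal.
  move=> C h; split; apply: ideal_gen_min; rewrite ?subset_refl //;
    try exact: ideal_gen_ideal.
    move=> _ [t _ <-]; rewrite arc_coef_fmap; apply: ideal_gen_sub.
    exists (arc_coef w (u t) (m t)) => //.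
    by apply: ideal_gen_sub; exists t.
  move=> _ [b gb <-]; apply: ideal_gen_morph gb => _ [t _ <-].
  by apply: ideal_gen_sub; apply: coefs_fmap.
- move=> q; split=> [q0|nq t].
    by move=> /ideal_gen_field[_ [t _ <-]]; rewrite q0 eqxx.
  apply: contrapT => /eqP c0; apply/nq/ideal_gen_field.
  by exists (arc_coef (pt_val q) (u t) (m t)) => //; exists t.
Qed.

(** A point with values in [K[t]] has an image in [K[[t]]]. *)
Lemma polynomial_arc (K : fieldType) (s : {rmorphism k -> K})
    (h : {rmorphism A -> {poly K}}) : (forall c, h (kalg_str A c) = (s c)%:P) ->
  exists w : arc (KAlg s), forall u m, arc_coef w u m = (h u)`_m.
Proof.
move=> hs; have strE n c :
    (@tpoly_of_poly n K \o h) (kalg_str A c) =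
    kalg_str (tpoly_alg n (KAlg s)) c.
  by rewrite /= hs tpoly_of_polyC.
pose w n : khom A (tpoly_alg n (KAlg s)) :=
  @KHom k A (tpoly_alg n (KAlg s)) (@tpoly_of_poly n K \o h) (strE n).
have wc n : @jet_trunc k n (spec A) (KAlg s) (w n.+1) = w n.
  by apply: khom_ext => u; apply/ffunP => i; rewrite !ffunE.
exists (exist _ w wc : arc (KAlg s)) => u m.
by rewrite /arc_coef /= ffunE.
Qed.

End Arcs.

Section SurfaceArcs.
Variables (k : fieldType) (f : {poly k}) (p : nat).
Hypotheses (f_irr : irreducible_poly f) (df0 : f^`() = 0).
Hypothesis p_char : p \in [pchar k].

Local Notation A := (surface_alg f p).
Let y : A := surface_j f p 'X.
Let z : A := surface_pi f p 'X.

(** Differentiating [f(x(t)) = y(t)^p z(t)] in characteristic [p], with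
    [f' = 0], gives [y(t)^p z'(t) = 0]. *)
Lemma surface_arc (K : fieldType) (s : {rmorphism k -> K})
    (w : arc_scheme (spec A) (KAlg s)) :
  arc_coef w z 1 = 0 \/ forall m, arc_coef w y m = 0.
Proof.
have p_gt0 : (0 < p)%N by apply: prime_gt0; apply: pcharf_prime p_char.
have [|/existsNP[m0 ym0]] := pselect (forall m, arc_coef w y m = 0).
  by right.
left; have exy : exists m, arc_coef w y m != 0 by exists m0; apply/eqP.
case: (ex_minnP exy) => m ym miny.
have ylt i : (i < m)%N -> arc_coef w y i = 0.
  by move=> lt; apply/eqP; apply: contraTT lt => /miny; rewrite -leqNgt.
(* Modulo [t ^ N.+1] the derivative of [y^p z] is known modulo [t ^ N]; for this
   [N] that is just beyond its leading term [y_m^p z_1 t ^ (m * p)]. *)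
pose N := (m * p).+1.
pose red : {rmorphism {poly K} -> tpoly N K} := @tpoly_of_poly N K.
have mN : (m <= N)%N by rewrite ltnW // ltnS leq_pmulr.
have coefE (a : A) (P : {poly K}) : red P = arc_jet w N a ->
    forall i, (i <= N)%N -> P`_i = arc_coef w a i.
  move=> Pa i; rewrite -ltnS => lt.
  have := congr1 (fun v : tpoly N K => v (Ordinal lt)) Pa.
  by rewrite /= (arc_jetE w a (Ordinal lt)) ffunE.
have [X XE] :=
  tpoly_of_poly_surj (arc_jet w N (surface_j f p 'X%:P) : tpoly N K).
have [Y YE] := tpoly_of_poly_surj (arc_jet w N y : tpoly N K).
have [Z ZE] := tpoly_of_poly_surj (arc_jet w N z : tpoly N K).
have fE g : arc_jet w N (surface_j f p g%:P) =
    red (map_poly s g \Po X) :> tpoly N K.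
  elim/poly_ind: g => [|g c IH].
    by rewrite map_poly0 comp_poly0 polyC0 !rmorph0.
  rewrite polyCD polyCM !rmorphD !rmorphM IH /= map_polyX map_polyC /=.
  rewrite comp_polyX comp_polyC -XE tpoly_of_polyC.
  by congr (_ + _); have := khom_str (arc_jet w N) c.
have := fE f; rewrite surface_eq // rmorphM rmorphXn -/y -/z -YE -ZE.
rewrite -rmorphXn -rmorphM => e.
have [W WE] : multiple 'X^(N.+1) (map_poly s f \Po X - Y ^+ p * Z).
  apply: dvd_Xn => i lt.
  have := congr1 (fun v : tpoly N K => v (Ordinal lt)) e.
  by rewrite !ffunE coefB => ->; rewrite subrr.
have p0 : p%:R = 0 :> {poly K}.
  by rewrite -(rmorph_nat (polyC \o s)) (pcharf0 p_char) rmorph0.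
have : Y ^+ p * Z^`() = 'X^N * - (W *+ N.+1 + 'X * W^`()).
  have := congr1 (@deriv K) WE.
  rewrite derivB deriv_comp deriv_map df0 rmorph0 comp_poly0 mul0r sub0r.
  rewrite [in LHS]derivM [in RHS]derivM derivXn deriv_exp.
  rewrite -mulr_natr p0 mulr0 mul0r add0r /= exprS.
  move/(congr1 -%R); rewrite opprK => ->; rewrite -mulr_natr; ring.
have [Y1 Y1E] : multiple 'X^m Y.
  by apply: dvd_Xn => i lt; rewrite (coefE y) ?ylt // ltnW // (leq_trans lt).
rewrite {1}Y1E exprMn -exprM /N exprSr -2!mulrA.
move/mulfI => /(_ _); rewrite expf_neq0 ?polyX_eq0 // => /(_ isT).
move/(congr1 (fun P : {poly K} => P.[0])); rewrite !hornerM hornerX mul0r.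
rewrite horner_exp !horner_coef0 coef_deriv mulr1n => /eqP.
rewrite mulf_eq0 expf_eq0 p_gt0 /= => /orP[/eqP Y10|/eqP Z1].
  move: ym; rewrite -(coefE y Y) // Y1E coefXnM ltnn subnn Y10 eqxx //.
by rewrite -(coefE z Z).
Qed.

Lemma surface_arcs_reducible : ~ irreducible (arc_scheme (spec A)).
Proof.
have p_gt0 : (0 < p)%N by apply: prime_gt0; apply: pcharf_prime p_char.
move=> [_ irr].
have Z1c := arc_zeros_closed (fun _ : unit => z) (fun=> 1%N).
have Z2c := arc_zeros_closed (fun _ : nat => y) id.
have [q|Z1|Z2] := irr _ _ Z1c Z2c.
- by have [z1|y0] := surface_arc (pt_val q); [left|right].
(* The arc [(alpha, 0, t)], where [alpha] is a root of [f]. *)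
- have [K [s [alpha root_alpha]]] := adjoin_root f_irr.
  have [theta [thetaj thetaz _]] :=
    surface_special_fibre f_irr p_gt0 root_alpha.
  have [c|w wE] := @polynomial_arc k A K s theta.
    by rewrite thetaj hornerC map_polyC /= hornerC.
  have /eqP := Z1 (@Point k (arc_scheme (spec A)) K s w) tt.
  by rewrite wE thetaz coefX oner_eq0.
(* The constant arc at the generic point. *)
pose L := {fraction {poly {poly k}}}.
pose inc : {rmorphism A -> L} := surface_inc f p.
have [c|w wE] := @polynomial_arc k A L (inc \o kalg_str A) (polyC \o inc).
  by [].
have : (inc y)%:P`_0 = 0.
  apply: etrans (esym (wE y 0%N)) _.
  exact: (Z2 (@Point k (arc_scheme (spec A)) L _ w)).
rewrite coefC eqxx => /eqP.
by rewrite surface_inc_j tofrac_eq0 polyX_eq0.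
Qed.

End SurfaceArcs.

Theorem theorem3p19 (k : fieldType) (hk : ~ perfect_field k) :
  exists X : kfunctor k,
    [/\ variety X, regular X, irreducible X & ~ irreducible (arc_scheme X)].
Proof.
have [f [f_irr df0]] := inseparable_irreducible hk.
have [p p_char] : exists p, p \in [pchar k].
  by apply: pchar_deriv0 df0; case: f_irr.
have p_gt0 : (0 < p)%N by apply: prime_gt0; apply: pcharf_prime p_char.
have [Xvar Xreg Xirr] := surface_variety f_irr p_gt0.
exists (spec (surface_alg f p)); split=> //.
exact: surface_arcs_reducible p_char.
Qed.
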